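(* Let $k$ be an algebraically closed field of arbitrary characteristic and let $n\ge 2$. Let $\mathcal D$ be a codimension one non-integrable distribution on $\mathbb P^n_k$ such that $\mathrm{Sing}(\mathcal D)$ has codimension at least $3$. Then $\mathcal D$ has no invariant hypersurface.
   Context: A codimension one distribution $\mathcal D$ of degree $d$ on $\mathbb P^n_k$ is given by a nonzero $\Omega\in H^0(\mathbb P^n_k,\Omega^1_{\mathbb P^n_k}(d+2))$, unique up to a scalar, whose zero locus $\mathrm{Sing}(\mathcal D)$ has codimension $\ge 2$. In homogeneous coordinates $\Omega=\sum_{i=0}^n A_i\,dx_i$ with $A_i$ homogeneous of degree $d+1$ and $i_R\Omega=0$, $R=\sum_i x_i\partial_{x_i}$. It is integrable if $\Omega\wedge d\Omega=0$. A reduced hypersurface $Y$ is invariant by $\mathcal D$ if $\omega\wedge\frac{df}{f}$ is a regular $2$-form for any local equation $f$ of $Y$ and any local $1$-form $\omega$ (with zero locus of codimension $\ge2$) defining $\mathcal D$. The empty set is regarded as having codimension larger than any integer. *)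

(* Defs.v *)
From HB Require Import structures.
From mathcomp Require Import all_boot all_order all_algebra.
From mathcomp Require Import fraction generic_quotient.
From mathcomp Require Import mpoly.
From mathcomp Require Import ring.

Set Implicit Arguments.
Unset Strict Implicit.
Unset Printing Implicit Defensive.

Import GRing.Theory.
Local Open Scope ring_scope.

(* A p-form \sum_{i_1 < .. < i_p} c_{i_1..i_p} dx_{i_1} /\ .. /\ dx_{i_p} is
   represented by its alternating coefficient function c. *)
Section CoordinateForms.

Definition wedge11 (R : comNzRingType) (m : nat) (a b : 'I_m -> R)
    (i j : 'I_m) : R :=
  a i * b j - a j * b i.

Definition wedge12 (R : comNzRingType) (m : nat) (a : 'I_m -> R)
    (b : 'I_m -> 'I_m -> R) (i j l : 'I_m) : R :=
  a i * b j l - a j * b i l + a l * b i j.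

Definition ext_d (R : comNzRingType) (m : nat) (a : 'I_m -> {mpoly R[m]})
    (i j : 'I_m) : {mpoly R[m]} :=
  (a j)^`M(i) - (a i)^`M(j).

End CoordinateForms.

Section ProjectiveSpace.

Variables (k : closedFieldType) (n : nat).

Local Notation poly := {mpoly k[n.+1]}.
Local Notation ratfun := {fraction {mpoly k[n.+1]}}.

(* A point of P^n is given by its homogeneous coordinates, a nonzero row
   vector; a subset of P^n by the (scaling-invariant) set of the coordinate
   vectors of its points. *)
Definition pset := 'rV[k]_n.+1 -> Prop.

Definition pspace : pset := fun v => v != 0.

Definition psubset (Z W : pset) : Prop := forall v, Z v -> W v.

Definition psame (Z W : pset) : Prop := forall v, Z v <-> W v.

Definition pclosed (Z : pset) : Prop :=
  exists S : poly -> Prop,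
    (forall p, S p -> exists e : nat, p \is e.-homog) /\
    psame Z (fun v => v != 0 /\ forall p, S p -> p.@[v 0] = 0).

Definition popen (U : pset) : Prop :=
  exists Z, pclosed Z /\ psame U (fun v => v != 0 /\ ~ Z v).

Definition closed_in (U Z : pset) : Prop :=
  exists C, pclosed C /\ psame Z (fun v => U v /\ C v).

Definition irreducible_in (U W : pset) : Prop :=
  [/\ closed_in U W, exists v, W v &
      forall Z1 Z2, closed_in U Z1 -> closed_in U Z2 ->
        psubset W (fun v => Z1 v \/ Z2 v) -> psubset W Z1 \/ psubset W Z2].

(* The codimension in U of a subset Z, closed in U, is at least c. The
   codimension is the infimum, over the irreducible closed subsets W of Z, of
   the supremum of the lengths of the chains W = C_0 < .. < C_r of irreducible
   closed subsets of U; it is infinite for Z empty. *)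
Definition codim_ge (U Z : pset) (c : nat) : Prop :=
  forall W, irreducible_in U W -> psubset W Z ->
    exists C : nat -> pset,
      [/\ psame (C 0%N) W,
          forall i, (i <= c)%N -> irreducible_in U (C i) &
          forall i, (i < c)%N ->
            psubset (C i) (C i.+1) /\ ~ psubset (C i.+1) (C i)].

Definition frac_of (p : poly) : ratfun := @FracField.tofrac _ p.

Definition regular_at (v : 'rV[k]_n.+1) (r : ratfun) : Prop :=
  exists p q : poly, q.@[v 0] != 0 /\ r = frac_of p / frac_of q.

Definition vanishes_at (v : 'rV[k]_n.+1) (r : ratfun) : Prop :=
  exists p q : poly,
    [/\ q.@[v 0] != 0, r = frac_of p / frac_of q & p.@[v 0] = 0].

Definition homog_ratfun (m : int) (r : ratfun) : Prop :=
  exists (e e' : nat) (p q : poly),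
    [/\ p \is e.-homog, q \is e'.-homog, q != 0,
        r = frac_of p / frac_of q & m = e%:Z - e'%:Z].

(* r is a section of O(m) over the open subset U *)
Definition section (m : int) (U : pset) (r : ratfun) : Prop :=
  homog_ratfun m r /\ forall v, U v -> regular_at v r.

Definition fderiv (i : 'I_n.+1) (r : ratfun) : ratfun :=
  let p := \n_(repr r) in let q := \d_(repr r) in
  frac_of (p^`M(i) * q - p * q^`M(i)) / frac_of (q ^+ 2).

Lemma ratfun_numden (r : ratfun) :
  r = frac_of \n_(repr r) / frac_of \d_(repr r).
Proof.
rewrite -[LHS]reprK; case: (repr r) => [[p q] /= q0].
rewrite /frac_of; unlock FracField.tofrac.
rewrite -[X in _ = _ * X]FracField.pi_inv -[RHS]FracField.pi_mul.
apply/eqmodP; rewrite /= FracField.equivfE /FracField.mulf /FracField.invf /=.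
by rewrite !numden_Ratio ?oner_neq0 ?mulf_neq0 ?oner_neq0 // mulr1 mul1r mulrC.
Qed.

Lemma fderivE (i : 'I_n.+1) (p q : poly) : q != 0 ->
  fderiv i (frac_of p / frac_of q) =
  frac_of (p^`M(i) * q - p * q^`M(i)) / frac_of (q ^+ 2).
Proof.
move=> q0; set r := _ / _; rewrite /fderiv.
have := ratfun_numden r; move: (denom_ratioP (repr r)).
move: (\n_(repr r)) (\d_(repr r)) => p1 q1 q10 E.
have frac0 (s : poly) : s != 0 -> frac_of s != 0 by rewrite tofrac_eq0.
have eqpq : p * q1 = p1 * q.
  apply/eqP; rewrite -tofrac_eq !tofracM -eqr_div ?frac0 //.
  by apply/eqP.
have dpq : p^`M(i) * q1 + p * q1^`M(i) = p1^`M(i) * q + p1 * q^`M(i).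
  by rewrite -!mderivM eqpq.
apply/eqP; rewrite eqr_div ?frac0 ?expf_neq0 // /frac_of -!tofracM tofrac_eq.
apply/eqP; move: (p^`M(i)) (q^`M(i)) (p1^`M(i)) (q1^`M(i)) dpq.
move=> dp dq dp1 dq1 /eqP; rewrite -subr_eq0 => /eqP dpq.
move/eqP: eqpq; rewrite -subr_eq0 => /eqP eqpq.
apply/eqP; rewrite -subr_eq0; apply/eqP.
transitivity ((p * q1 - p1 * q) * (q * dq1 + q1 * dq)
  - q1 * q * (dp * q1 + p * dq1 - (dp1 * q + p1 * dq))); first by ring.
by rewrite eqpq dpq mul0r mulr0 subr0.
Qed.

(* By the Euler sequence, the sections of Omega^p over an open subset U of P^n
   are the p-forms in dx_0, .., dx_n which are contracted to 0 by the radial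
   vector field R and whose coefficients are regular over U and homogeneous of
   degree -p. *)
Definition regular_1form (U : pset) (w : 'I_n.+1 -> ratfun) : Prop :=
  (forall i, section (- 1) U (w i)) /\
  \sum_(i < n.+1) frac_of 'X_i * w i = 0.

Definition regular_2form (U : pset) (b : 'I_n.+1 -> 'I_n.+1 -> ratfun) : Prop :=
  [/\ forall i, b i i = 0,
      forall i j, b j i = - b i j,
      forall i j, section (- 2%:Z) U (b i j) &
      forall j, \sum_(i < n.+1) frac_of 'X_i * b i j = 0].

Definition zeros_1form (U : pset) (w : 'I_n.+1 -> ratfun) : pset :=
  fun v => U v /\ forall i, vanishes_at v (w i).

Definition poly_zeros (A : 'I_n.+1 -> poly) : pset :=
  fun v => v != 0 /\ forall i, (A i).@[v 0] = 0.

(* The form is \sum_i dist_coef i dx_i, a section of Omega^1(dist_deg + 2). *)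
Record distribution := Distribution {
  dist_deg : nat;
  dist_coef : 'I_n.+1 -> poly;
  dist_homog : forall i, dist_coef i \is (dist_deg.+1).-homog;
  dist_radial : \sum_(i < n.+1) 'X_i * dist_coef i = 0;
  dist_neq0 : exists i, dist_coef i != 0;
  dist_codim : codim_ge pspace (poly_zeros dist_coef) 2
}.

Definition Sing (D : distribution) : pset := poly_zeros (dist_coef D).

Definition integrable (D : distribution) : Prop :=
  forall i j l, wedge12 (dist_coef D) (ext_d (dist_coef D)) i j l = 0.

Definition local_form (D : distribution) (U : pset)
    (w : 'I_n.+1 -> ratfun) : Prop :=
  [/\ regular_1form U w,
      exists2 g : ratfun, g != 0 & forall i, w i = g * frac_of (dist_coef D i) &
      codim_ge U (zeros_1form U w) 2].

Definition square_free (F : poly) : Prop :=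
  forall G H : poly, F = G ^+ 2 * H -> G \is a GRing.unit.

Record reduced_hypersurface := ReducedHypersurface {
  hyp_deg : nat;
  hyp_eq : poly;
  hyp_deg_gt0 : (0 < hyp_deg)%N;
  hyp_homog : hyp_eq \is hyp_deg.-homog;
  hyp_neq0 : hyp_eq != 0;
  hyp_reduced : square_free hyp_eq
}.

(* f generates the ideal sheaf of Y over U: it differs from the homogeneous
   equation of Y by a nowhere vanishing section of O(hyp_deg Y) over U. *)
Definition local_equation (Y : reduced_hypersurface) (U : pset)
    (f : ratfun) : Prop :=
  [/\ f != 0, section 0 U f,
      section (hyp_deg Y)%:Z U (frac_of (hyp_eq Y) / f) &
      section (- (hyp_deg Y)%:Z) U (f / frac_of (hyp_eq Y))].

Definition is_invariant (D : distribution) (Y : reduced_hypersurface) : Prop :=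
  forall (U : pset) (f : ratfun) (w : 'I_n.+1 -> ratfun),
    popen U -> local_equation Y U f -> local_form D U w ->
    regular_2form U (wedge11 w (fun i => fderiv i f / f)).

End ProjectiveSpace.

(* Main.v *)
(* Let Omega = sum A_i dx_i, with the A_i of degree d + 1, and let F = 0 be an
   invariant hypersurface.  On the charts x_l <> 0 invariance says that F locally
   divides Omega /\ dF; the ideal of the q such that F divides q Omega /\ dF has
   no zero in P^n, so by the Nullstellensatz Omega /\ dF = F Theta, where Theta has
   coefficients of degree d.  Since Omega /\ Theta = 0 and Sing has codimension at
   least 3, exactness of the Koszul complex of the A_i in degree 2 gives Theta the
   form Omega /\ eta; but Theta has smaller degree than Omega, so Theta = 0.  Thus
   Omega and dF are proportional: either dF <> 0 and Omega is integrable, or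
   dF = 0 and F is a p-th power, hence not reduced.

   The codimension is used as follows.  A homogeneous ideal J maximal among those
   whose zero locus meets every linear subspace of codimension r is prime (Zorn),
   so its zero locus is irreducible; each step of a chain of irreducible closed
   sets saves one linear form (Noether normalization).  Hence Sing misses a plane,
   and restricting to this plane puts powers of its three coordinates in the ideal
   of the A_i.  The case r = 0 of the same maximality argument proves the
   Nullstellensatz. *)

Require Import Defs.
From mathcomp Require Import all_boot all_order all_algebra.
From mathcomp Require Import fraction mpoly ring zify.
From mathcomp Require boolp classical_sets.

Set Implicit Arguments.
Unset Strict Implicit.
Unset Printing Implicit Defensive.

Import GRing.Theory.
Local Open Scope ring_scope.

(** * Homogeneous components of products and scaled substitutions *)

Section Homogeneous.

Variables (n : nat) (R : comNzRingType).
Implicit Types p q : {mpoly R[n]}.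

Lemma pihomog_ge d p : (msize p <= d)%N -> pihomog mdeg d p = 0.
Proof.
move=> ge; rewrite pihomogE big_seq_cond big1 // => m /andP [mp /eqP md].
by move: (mmeasure_mnm_lt mdeg mp); rewrite md ltnNge ge.
Qed.

Lemma pihomogMl e p q d : p \is e.-homog ->
  pihomog mdeg (e + d) (p * q) = p * pihomog mdeg d q.
Proof.
move=> hp; pose K := mmeasure mdeg q.
rewrite {1}(pihomog_partitionE (leqnn K)) mulr_sumr raddf_sum /=.
rewrite (eq_bigr (fun i : 'I_K =>
  if i == d :> nat then p * pihomog mdeg d q else 0)); last first.
  move=> i _; have [->|ne] := altP eqP.
    by apply: pihomog_dE; rewrite dhomogM ?pihomogP.
  rewrite (@pihomog_ne0 _ _ _ (e + i)) ?eqn_add2l // dhomogM ?pihomogP //.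
have [lt|ge] := ltnP d K.
  rewrite (bigD1 (Ordinal lt)) //= eqxx big1 ?addr0 // => i.
  by rewrite -val_eqE /= => /negbTE ->.
rewrite big1 => [|i _]; first by rewrite pihomog_ge ?mulr0.
by case: eqP => // di; move: (ltn_ord i); rewrite di ltnNge ge.
Qed.

Lemma pihomogMl_lt e p q d : p \is e.-homog -> (d < e)%N ->
  pihomog mdeg d (p * q) = 0.
Proof.
move=> hp lt; rewrite (pihomog_partitionE (leqnn (mmeasure mdeg q))).
rewrite mulr_sumr raddf_sum /= big1 // => i _.
rewrite (@pihomog_ne0 _ _ _ (e + i)) ?dhomogM ?pihomogP //.
by rewrite gtn_eqF // ltn_addr.
Qed.

End Homogeneous.

Section Substitution.

Variables (n : nat) (R S : comNzRingType) (f : {rmorphism R -> S}).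

Lemma mmap_homog (h : 'I_n -> S) c d (p : {mpoly R[n]}) : p \is d.-homog ->
  mmap f (fun i => c * h i) p = c ^+ d * mmap f h p.
Proof.
move=> /dhomogP hp; rewrite /mmap mulr_sumr !big_seq; apply: eq_bigr => m mp.
rewrite mulrCA; congr (_ * _); rewrite /mmap1.
under eq_bigr do rewrite exprMn; rewrite big_split /=; congr (_ * _).
by rewrite prodrXr -mdegE (hp _ mp).
Qed.

End Substitution.

(** * Ideals as predicates, congruences, adjoined generators *)

Section Ideals.

Variable R : comNzRingType.

Definition ideal (J : R -> Prop) :=
  [/\ J 0, forall p q, J p -> J q -> J (p + q) & forall p q, J q -> J (p * q)].

Lemma ideal0 J : ideal J -> J 0. Proof. by case. Qed.
Lemma idealD J p q : ideal J -> J p -> J q -> J (p + q).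
Proof. by case=> _ + _; apply. Qed.
Lemma idealM J p q : ideal J -> J q -> J (p * q).
Proof. by case=> _ _; apply. Qed.
Lemma idealMr J p q : ideal J -> J p -> J (p * q).
Proof. by rewrite mulrC; apply: idealM. Qed.
Lemma idealN J p : ideal J -> J p -> J (- p).
Proof. by move=> iJ Jp; rewrite -mulN1r; apply: idealM. Qed.
Lemma idealB J p q : ideal J -> J p -> J q -> J (p - q).
Proof. by move=> iJ Jp Jq; apply: idealD => //; apply: idealN. Qed.
Lemma idealBK J p q : ideal J -> J (p - q) -> J q -> J p.
Proof. by move=> iJ Jpq Jq; rewrite -(subrK q p); apply: idealD. Qed.
Lemma ideal_sum J (I : Type) (r : seq I) (P : pred I) (F : I -> R) : ideal J ->
  (forall i, P i -> J (F i)) -> J (\sum_(i <- r | P i) F i).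
Proof.
move=> iJ JF; elim/big_rec: _ => [|i x Pi Jx]; first exact: ideal0.
by apply: idealD => //; apply: JF.
Qed.

Lemma ideal_congrM J p p' q q' : ideal J -> J (p - p') -> J (q - q') ->
  J (p * q - p' * q').
Proof.
move=> iJ Jp Jq.
have -> : p * q - p' * q' = q * (p - p') + p' * (q - q') by ring.
by apply: idealD => //; apply: idealM.
Qed.

Lemma ideal_congrX J p p' e : ideal J -> J (p - p') -> J (p ^+ e - p' ^+ e).
Proof.
move=> iJ Jp; elim: e => [|e IH]; first by rewrite subrr; apply: ideal0.
by rewrite !exprS; apply: ideal_congrM.
Qed.

Lemma ideal_congr_mmap J n (Q : comNzRingType) (f : {rmorphism Q -> R})
    (h h' : 'I_n -> R) (p : {mpoly Q[n]}) :
  ideal J -> (forall i, J (h i - h' i)) -> J (mmap f h p - mmap f h' p).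
Proof.
move=> iJ Jh; rewrite /mmap -sumrB; apply: ideal_sum => // m _.
rewrite -mulrBr; apply: idealM => //; rewrite /mmap1.
elim/big_ind2: _ => [|x1 x2 y1 y2|i _]; first by rewrite subrr; apply: ideal0.
  exact: ideal_congrM.
exact: ideal_congrX.
Qed.

Definition adj r (J : R -> Prop) (l : 'I_r -> R) (p : R) :=
  exists g : 'I_r -> R, J (p - \sum_i g i * l i).

Lemma ideal_adj r J (l : 'I_r -> R) : ideal J -> ideal (adj J l).
Proof.
move=> iJ; split.
- exists (fun=> 0); rewrite big1 ?subrr; first exact: ideal0.
  by move=> i _; rewrite mul0r.
- move=> p q [g gp] [h hq]; exists (fun i => g i + h i).
  under eq_bigr do rewrite mulrDl.
  by rewrite big_split /= opprD addrACA; apply: idealD.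
- move=> p q [g gq]; exists (fun i => p * g i).
  under eq_bigr do rewrite -mulrA.
  by rewrite -mulr_sumr -mulrBr; apply: idealM.
Qed.

Lemma adj_sub r J (l : 'I_r -> R) p : J p -> adj J l p.
Proof.
move=> Jp; exists (fun=> 0); rewrite big1 ?subr0 // => i _; exact: mul0r.
Qed.

Lemma adj_gen r J (l : 'I_r -> R) i : ideal J -> adj J l (l i).
Proof.
move=> iJ; exists (fun j => (j == i)%:R); rewrite (bigD1 i) //= eqxx mul1r.
rewrite big1 ?addr0 ?subrr; first exact: ideal0.
by move=> j /negbTE ->; rewrite mul0r.
Qed.

Lemma adj_mono r (J J' : R -> Prop) (l : 'I_r -> R) p :
  (forall q, J q -> J' q) -> adj J l p -> adj J' l p.
Proof. by move=> JJ' [g gp]; exists g; apply: JJ'. Qed.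

Lemma adj_min r (J J' : R -> Prop) (l : 'I_r -> R) p : ideal J' ->
  (forall q, J q -> J' q) -> (forall i, J' (l i)) -> adj J l p -> J' p.
Proof.
move=> iJ' JJ' J'l [g /JJ' gp]; apply: (idealBK iJ' gp).
by apply: ideal_sum => // i _; apply: idealM.
Qed.

End Ideals.

(** * Homogeneous ideals and powers of the irrelevant ideal *)

Section HomogeneousIdeals.

Variables (n : nat) (k : fieldType).
Local Notation S := {mpoly k[n]}.
Implicit Types (J : S -> Prop) (p q : S).

Definition hideal J :=
  ideal J /\ forall d p, J p -> J (pihomog mdeg d p).

(** Containment of a power of the irrelevant ideal is the algebraic form of an empty projective zero
    locus. Only finitely many monomials are involved, so the condition passes from the union of a
    chain to a member. *)
Definition mpow s J := forall m : 'X_{1..n}, mdeg m = s -> J 'X_[m].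

Lemma mpow_homog s J p : ideal J -> mpow s J -> p \is s.-homog -> J p.
Proof.
move=> iJ ms /dhomogP hp; rewrite [p]mpolyE big_seq; apply: ideal_sum => // m mp.
by rewrite -mul_mpolyC; apply: idealM => //; apply: ms; apply: hp.
Qed.

Lemma mdeg_split (m : 'X_{1..n}) s : (s <= mdeg m)%N ->
  exists m1 m2, m = (m1 + m2)%MM /\ mdeg m1 = s.
Proof.
elim: s => [|s IH] lt.
  by exists 0%MM, m; rewrite add0m mdeg0.
have [m1 [m2 [E d1]]] := IH (ltnW lt).
have : mdeg m2 != 0%N.
  by apply/eqP => d2; move: lt; rewrite E mdegD d1 d2 addn0 ltnn.
rewrite mdeg_eq0 => /eqP m2n0.
have [i mi] : exists i, m2 i != 0%N.
  apply/existsP; apply: contraT; rewrite negb_exists => /forallP H.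
  by case: m2n0; apply/mnmP => i; rewrite mnm0E; apply/eqP/negPn/H.
exists (m1 + U_(i))%MM, (m2 - U_(i))%MM; split; last by rewrite mdegD mdeg1 d1 addn1.
by rewrite E -addmA [(U_(i) + _)%MM]addmC submK // lep1mP.
Qed.

Lemma mpow_leq s t J : ideal J -> mpow s J -> (s <= t)%N -> mpow t J.
Proof.
move=> iJ ms st m mt; have [|m1 [m2 [-> d1]]] := @mdeg_split m s.
  by rewrite mt.
by rewrite mpolyXD; apply: idealMr => //; apply: ms.
Qed.

Lemma hideal_adj r J (l : 'I_r -> S) (d : 'I_r -> nat) : hideal J ->
  (forall i, l i \is (d i).-homog) -> hideal (adj J l).
Proof.
move=> [iJ hJ] hl; split; first exact: ideal_adj.
move=> e p [g Jg].
(* For [e < d i] the truncated [e - d i] would select the constant term of [g i], whereas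
   [g i * l i] has no component of degree [e]. *)
exists (fun i => if (d i <= e)%N then pihomog mdeg (e - d i)%N (g i) else 0).
rewrite (_ : _ - _ = pihomog mdeg e (p - \sum_i g i * l i)); first exact: hJ.
rewrite pihomogB; congr (_ - _); rewrite (raddf_sum (pihomog mdeg e)) /=.
apply: eq_bigr => i _.
case: leqP => di; last by rewrite mul0r mulrC (pihomogMl_lt _ (hl i)).
by rewrite mulrC [g i * _]mulrC -(pihomogMl _ _ (hl i)) subnKC.
Qed.

Definition lform r (L : 'M[k]_(r, n)) (j : 'I_r) : S := \sum_i L j i *: 'X_i.

Lemma lform_homog r (L : 'M[k]_(r, n)) j : lform L j \is 1.-homog.
Proof. by apply: rpred_sum => i _; apply: rpredZ; rewrite dhomogX /= mdeg1. Qed.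

(* The zero locus of J misses a linear subspace of codimension at most r. *)
Definition cut_empty r J := exists (L : 'M[k]_(r, n)) s, mpow s.+1 (adj J (lform L)).

Lemma hideal_adj_lform r (L : 'M[k]_(r, n)) J :
  hideal J -> hideal (adj J (lform L)).
Proof. by move=> hJ; apply: hideal_adj hJ _ => i; apply: lform_homog. Qed.

Lemma adj_homog1 r (l : 'I_r -> S) J p s : hideal J ->
  (forall i, l i \is 1.-homog) -> p \is s.+1.-homog -> adj J l p ->
  exists g : 'I_r -> S,
    (forall i, g i \is s.-homog) /\ J (p - \sum_i g i * l i).
Proof.
move=> [iJ hJ] hl hp [g Jg]; exists (fun i => pihomog mdeg s (g i)).
split=> [i|]; first exact: pihomogP.
move/(hJ s.+1): Jg; rewrite pihomogB (pihomog_dE hp).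
rewrite (raddf_sum (pihomog mdeg s.+1)) /=; congr (J (_ - _)); apply: eq_bigr.
by move=> i _; rewrite mulrC -add1n (pihomogMl _ _ (hl i)) mulrC.
Qed.

End HomogeneousIdeals.

(** * Points where a polynomial does not vanish *)

Section Points.

(** [muni] only regroups monomials: an exponent is determined by its last entry and the remaining
    ones, so no coefficient of [p] is lost. *)
Lemma muni_neq0 (R : nzRingType) n (p : {mpoly R[n.+1]}) : p != 0 -> muni p != 0.
Proof.
apply: contraNneq => p0; apply/eqP/mpolyP => m; rewrite mcoeff0.
pose w (m : 'X_{1..n.+1}) := [multinom m (widen_ord (leqnSn n) i) | i < n].
have wI m1 m2 : w m1 = w m2 -> m1 ord_max = m2 ord_max -> m1 = m2.
  move=> ww mm; apply/mnmP => i; have [->|ne] := eqVneq i ord_max => //.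
  have lt : (i < n)%N by rewrite ltn_neqAle -ltnS ltn_ord andbT.
  move/mnmP/(_ (Ordinal lt)): ww; rewrite !mnmE.
  by have -> : widen_ord (leqnSn n) (Ordinal lt) = i by apply: val_inj.
have := congr1 (fun q : {poly {mpoly R[n]}} => q`_(m ord_max)@_(w m)) p0.
rewrite muniE coef0 mcoeff0 => <-; rewrite coef_sum raddf_sum /= {1}[p]mpolyE.
rewrite raddf_sum /=; apply: eq_bigr => m' _.
rewrite mcoeffZ mcoeffX coefZ coefXn.
have [->|ne] := eqVneq m' m.
  by rewrite eqxx !mulr1 mcoeffZ mcoeffX eqxx mulr1.
have [mm|] := eqVneq; last by rewrite !mulr0 mcoeff0.
rewrite mulr1 mcoeffZ mcoeffX; have [ww|] := eqVneq; last by rewrite !mulr0.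
by rewrite (wI _ _ ww) ?eqxx // in ne.
Qed.

(** Induction on the number of variables: at a point off the leading coefficient in the last
    variable, a nonzero univariate polynomial remains, and it has a nonroot. *)
Lemma mpoly_nonzero_point (k : closedFieldType) n (p : {mpoly k[n]}) :
  p != 0 -> exists v, p.@[v] != 0.
Proof.
elim: n p => [|n IH] p p0.
  exists (fun=> 0); rewrite [p]nvar0_mpolyC mevalC; apply: contraNneq p0 => E.
  by rewrite [p]nvar0_mpolyC E.
have := muni_neq0 p0; rewrite -lead_coef_eq0 => /IH [v pv].
have : map_poly (meval v) (muni p) != 0.
  apply: contraNneq pv => /(congr1 (fun q : {poly k} => q`_(size (muni p)).-1)).
  by rewrite coef_map coef0 => ->.
move=> /closed_nonrootP [t pt]; pose w i := oapp v t (unlift ord_max i).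
exists w; apply: contraNneq pt => pw; rewrite /root -[X in _ == X]pw.
rewrite muniE rmorph_sum /= horner_sum mevalE; apply/eqP/eq_bigr => m _.
rewrite map_polyZ /= map_polyXn hornerZ hornerXn mevalZ mevalX -mulrA.
congr (_ * _); rewrite big_ord_recr /= /w unlift_none; congr (_ * _).
apply: eq_bigr => i _; rewrite mnmE.
have -> : widen_ord (leqnSn n) i = lift ord_max i.
  by apply: val_inj; rewrite /= /bump leqNgt ltn_ord.
by rewrite liftK.
Qed.

End Points.

(** * The monomial basis of the forms of a given degree *)

Section MonomialBasis.

Variables (n : nat) (k : fieldType).
Local Notation S := {mpoly k[n]}.

Definition mon_of_deg s := {m : 'X_{1..n < s.+1} | mdeg m == s}.
Definition mon s (i : 'I_#|{: mon_of_deg s}|) : 'X_{1..n} :=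
  bmnm (val (enum_val i)).

Lemma mdeg_mon s i : mdeg (@mon s i) = s.
Proof. by rewrite /mon; case: (enum_val i) => m /= /eqP. Qed.

Lemma mon_surj s m : mdeg m = s -> exists i, @mon s i = m.
Proof.
move=> ms; have lt : (mdeg m < s.+1)%N by rewrite ms.
have e : mdeg (BMultinom lt) == s by rewrite /= ms.
by exists (enum_rank (exist _ (BMultinom lt) e)); rewrite /mon enum_rankK.
Qed.

Lemma mon_inj s : injective (@mon s).
Proof. by move=> i j /val_inj/val_inj/enum_val_inj. Qed.

Lemma homog_monE s (p : S) : p \is s.-homog ->
  p = \sum_i p@_(@mon s i) *: 'X_[mon i].
Proof.
move=> hp; apply/mpolyP => m; rewrite raddf_sum /=.
have [ms|ne] := eqVneq (mdeg m) s; last first.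
  rewrite (dhomog_nemf_coeff hp ne) big1 // => i _.
  rewrite mcoeffZ mcoeffX; case: eqP => [E|]; last by rewrite mulr0.
  by rewrite -E mdeg_mon eqxx in ne.
have [i <-] := mon_surj ms; rewrite (bigD1 i) //= mcoeffZ mcoeffX eqxx mulr1.
rewrite big1 ?addr0 // => j ji; rewrite mcoeffZ mcoeffX.
by rewrite (inj_eq (@mon_inj s)) (negbTE ji) mulr0.
Qed.

End MonomialBasis.

(** * Maximal homogeneous ideals with zeros on all subspaces of codimension r *)

Section Maximal.

Variables (n : nat) (k : closedFieldType).
Local Notation S := {mpoly k[n]}.
Implicit Types (J : S -> Prop) (p q : S).

(* Moving the linear forms along a line deforms the identity matrix, which
   expresses the monomials of degree s.+1 in terms of themselves, into
   1 + tB. *)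
Lemma adj_lform_line r (L N : 'M[k]_(r, n)) s J : hideal J ->
  mpow s.+1 (adj J (lform L)) ->
  exists2 P : {poly k}, P != 0 &
    forall t, P.[t] != 0 -> mpow s.+1 (adj J (lform (L + t *: N))).
Proof.
move=> hJ ms; have [iJ _] := hJ.
have /fin_all_exists [g Hg] (i : 'I_#|{: mon_of_deg n s.+1}|) :
    exists g : 'I_r -> S, (forall a, g a \is s.-homog) /\
      J ('X_[mon i] - \sum_a g a * lform L a).
  apply: adj_homog1 => //; first exact: lform_homog.
    by rewrite dhomogX /= mdeg_mon.
  by apply: ms; rewrite mdeg_mon.
pose B : 'M[k]_#|{: mon_of_deg n s.+1}| :=
  \matrix_(i, j) (\sum_a g i a * lform N a)@_(mon j).
have BE i : \sum_a g i a * lform N a = \sum_j B i j *: 'X_[mon j].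
  rewrite [LHS](@homog_monE _ _ s.+1); first by apply: eq_bigr => j _; rewrite mxE.
  apply: rpred_sum => a _; rewrite -addn1.
  by apply: dhomogM; [case: (Hg i) | apply: lform_homog].
pose P := \det (1%:M + 'X *: map_mx polyC B).
have PE t : P.[t] = \det (1%:M + t *: B).
  rewrite -horner_evalE -det_map_mx; congr (\det _); apply/matrixP => i j.
  by rewrite !mxE /= /horner_eval hornerD hornerM hornerX hornerC hornerMn hornerC.
exists P.
  apply/eqP => P0; have := PE 0; rewrite P0 horner0 scale0r addr0 det1.
  by move/eqP; rewrite eq_sym oner_eq0.
move=> t; rewrite PE => Pt m /mon_surj [j <-].
have iL : ideal (adj J (lform (L + t *: N))) by apply: ideal_adj.
pose M := 1%:M + t *: B; have uM : M \in unitmx by rewrite unitmxE unitfE.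
have MX i : adj J (lform (L + t *: N)) (\sum_j M i j *: 'X_[mon j]).
  have -> : \sum_j M i j *: 'X_[mon j] =
      'X_[mon i] + t *: \sum_a g i a * lform N a :> S.
    rewrite BE scaler_sumr; under eq_bigr do rewrite !mxE scalerDl -scalerA.
    rewrite big_split /= (bigD1 i) //= eqxx scale1r big1 ?addr0.
      by congr (_ + _); apply: eq_bigr => b _; rewrite mxE.
    by move=> b; rewrite eq_sym => /negbTE ->; rewrite scale0r.
  exists (g i); case: (Hg i) => _; congr (J _).
  under [X in _ = _ - X]eq_bigr => a _.
    rewrite (_ : lform _ a = lform L a + t *: lform N a); last first.
      rewrite /lform scaler_sumr -big_split; apply: eq_bigr => b _.
      by rewrite !mxE scalerDl scalerA.
    rewrite mulrDr -scalerAr; over.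
  by rewrite big_split /= -scaler_sumr opprD addrACA subrr addr0.
have -> : 'X_[mon j] = \sum_i invmx M j i *: \sum_b M i b *: ('X_[mon b] : S).
  under eq_bigr do rewrite scaler_sumr; rewrite exchange_big /=.
  under eq_bigr => b _.
    under eq_bigr do rewrite scalerA.
    rewrite -scaler_suml (_ : \sum_i _ = (invmx M *m M) j b); last by rewrite mxE.
    rewrite mulVmx // mxE; over.
  rewrite (bigD1 j) //= eqxx scale1r big1 ?addr0 // => b.
  by rewrite eq_sym => /negbTE ->; rewrite scale0r.
apply: ideal_sum => // i _; rewrite -mul_mpolyC; apply: idealM => //.
Qed.

Definition max_uncut r J := [/\ hideal J, ~ cut_empty r J &
  forall J', hideal J' -> (forall p, J p -> J' p) -> ~ cut_empty r J' ->
    forall p, J' p -> J p].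

Lemma max_uncut_exists r J0 : hideal J0 -> ~ cut_empty r J0 ->
  exists2 J, max_uncut r J & forall p, J0 p -> J p.
Proof.
move=> hJ0 nJ0.
pose Q (J : S -> Prop) := [/\ hideal J, ~ cut_empty r J & forall p, J0 p -> J p].
pose P (J : S -> Prop) := Q J \/ (forall p, ~ J p).
have [F FP totF|J [PJ maxJ]] := @classical_sets.Zorn_bigcup S P.
  pose U := classical_sets.bigcup F id.
  have [[X0 FX0 QX0]|nF] := boolp.pselect (exists2 X, F X & Q X); last first.
    right=> p [X FX Xp]; have [QX|X0] := FP _ FX; last exact: X0 Xp.
    by apply: nF; exists X.
  have top X Y : F X -> F Y -> exists2 Z, F Z &
      (forall p, X p -> Z p) /\ (forall p, Y p -> Z p).
    by move=> FX FY; have [XY|YX] := totF _ _ FX FY; [exists Y|exists X].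
  have FQ X p : F X -> X p -> Q X.
    by move=> FX Xp; have [//|/(_ p)] := FP _ FX.
  left; split.
  - split; first split.
    + by exists X0 => //; case: QX0 => [[/ideal0]].
    + move=> p q [X FX Xp] [Y FY Yq]; have [Z FZ [XZ YZ]] := top _ _ FX FY.
      exists Z => //; have [[iZ _] _ _] := FQ _ _ FZ (XZ _ Xp).
      by apply: idealD => //; [apply: XZ | apply: YZ].
    + move=> p q [X FX Xq]; exists X => //; have [[iX _] _ _] := FQ _ _ FX Xq.
      exact: idealM.
    + move=> d p [X FX Xp]; exists X => //; have [[_ hX] _ _] := FQ _ _ FX Xp.
      exact: hX.
  (* The condition on the union concerns the finitely many monomials of degree [s.+1], hence holds
     already in one member of the chain. *)
  - move=> [L [s ms]].
    have [X FX [QX HX]] : exists2 X, F X & Q X /\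
        forall m, m \in [seq @mon n s.+1 i | i : 'I__] -> adj X (lform L) 'X_[m].
      have : forall m, m \in [seq @mon n s.+1 i | i : 'I__] ->
          exists2 X, F X & adj X (lform L) 'X_[m].
        move=> m /mapP [i _ ->]; have [g [X FX Xg]] := ms _ (mdeg_mon i).
        by exists X => //; exists g.
      elim: [seq _ | _ : _] => [|m l IH] Hl; first by exists X0.
      have [|X FX [QX HX]] := IH.
        by move=> m' m'l; apply: Hl; rewrite inE m'l orbT.
      have [Y FY HY] := Hl m (mem_head _ _).
      have [Z FZ [XZ YZ]] := top _ _ FX FY; exists Z => //; split.
        by case: QX => [[iX _] _ _]; apply: FQ FZ (XZ 0 (ideal0 iX)).
      move=> m'; rewrite inE => /orP [/eqP ->|m'l].
        exact: adj_mono HY.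
      exact: adj_mono (HX _ m'l).
    case: QX => _ + _; apply; exists L, s => m /mon_surj [i <-].
    by apply: HX; apply: map_f; rewrite mem_enum.
  - by move=> p J0p; exists X0 => //; case: QX0 => _ _; apply.
have [[hJ nJ J0J]|J_0] := PJ.
  exists J => //; split=> // J' hJ' JJ' nJ' p J'p; apply: boolp.contrapT => Jp.
  apply: (maxJ J'); last by left; split=> // q /J0J/JJ'.
  by split=> // /(_ p J'p).
case: (maxJ J0); last by left.
split=> [p /J_0//|/(_ 0)]; case: hJ0 => [/ideal0 J00 _] /(_ J00).
exact: J_0.
Qed.

Definition adj_one J p := adj J (fun _ : 'I_1 => p).

Lemma adj_oneP J p q : adj_one J p q <-> exists g, J (q - g * p).
Proof.
split=> [[g]|[g Jg]]; first by rewrite big_ord1; exists (g ord0).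
by exists (fun=> g); rewrite big_ord1.
Qed.

Lemma hideal_adj_one J p d : hideal J -> p \is d.-homog -> hideal (adj_one J p).
Proof. by move=> hJ hp; apply: (@hideal_adj _ _ _ _ _ (fun=> d)). Qed.

Lemma max_uncut_adj_one r J p d : max_uncut r J -> p \is d.-homog -> ~ J p ->
  cut_empty r (adj_one J p).
Proof.
move=> [hJ nJ maxJ] hp nJp; apply: boolp.contrapT => nJ'; apply: nJp.
apply: (maxJ _ (hideal_adj_one hJ hp) _ nJ') => [q|]; first exact: adj_sub.
by apply: (adj_gen (fun=> p) (ord0 : 'I_1)); case: hJ.
Qed.

(** If neither factor lies in [J], then by maximality some [L1] cuts J + (p) and some [L2] cuts J +
    (q) down to the empty set. On the line through [L1] and [L2] both properties persist off
    finitely many points, so one [L] serves both; multiplying the two expressions of monomials then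
    shows that [L] cuts [J] itself. *)
Lemma max_uncut_prime r J p q d e : max_uncut r J ->
  p \is d.-homog -> q \is e.-homog -> J (p * q) -> J p \/ J q.
Proof.
move=> mJ hp hq Jpq; have [hJ nJ _] := mJ; have [iJ _] := hJ.
have [Jp|nJp] := boolp.pselect (J p); first by left.
right; apply: boolp.contrapT => nJq; apply: nJ.
have [L1 [s1 m1]] := max_uncut_adj_one mJ hp nJp.
have [L2 [s2 m2]] := max_uncut_adj_one mJ hq nJq.
have [P1 P1n H1] := adj_lform_line (L2 - L1) (hideal_adj_one hJ hp) m1.
have [P2 P2n H2] := adj_lform_line (L1 - L2) (hideal_adj_one hJ hq) m2.
(* Since L1 + t (L2 - L1) = L2 + (1 - t) (L1 - L2), the second polynomial is needed at 1 - t. *)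
have P2c : P2 \Po (1 - 'X) != 0.
  apply: contraNneq P2n => /(congr1 (fun P => P \Po (1 - 'X))).
  rewrite -comp_polyA comp_polyB comp_polyX rmorph1 subKr comp_polyXr.
  by rewrite comp_poly0 => ->.
have /closed_nonrootP [t] := mulf_neq0 P1n P2c.
rewrite rootM negb_or /root horner_comp !hornerE => /andP [/H1 {}H1 /H2 {}H2].
set L := L1 + _ in H1; have LE : L2 + (1 - t) *: (L1 - L2) = L.
  rewrite /L scalerBl scale1r addrA subrKC; congr (_ + _).
  by rewrite -scalerN opprB.
rewrite LE in H2; exists L, (s1 + s2.+1)%N => m ms.
have iL : ideal (adj J (lform L)) by apply: ideal_adj.
have [|x1 [x2 [E d1]]] := @mdeg_split _ m s1.+1; first by rewrite ms; lia.
move: ms; rewrite E mdegD d1 addSn => /eqP; rewrite eqSS eqn_add2l => /eqP d2.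
have key x h : adj (adj_one J h) (lform L) x -> exists g, adj J (lform L) (x - g * h).
  move=> [g /adj_oneP [b Jb]]; exists b, g; congr (J _): Jb; ring.
have [g1 {}H1] := key _ _ (H1 _ d1); have [g2 {}H2] := key _ _ (H2 _ d2).
rewrite mpolyXD; apply: (idealBK iL (ideal_congrM iL H1 H2)).
by rewrite mulrACA; apply: idealM => //; apply: adj_sub.
Qed.

End Maximal.

(** * Evaluation and substitution along a line *)

Section Evaluation.

Variables (n : nat) (R : comNzRingType).
Implicit Type p : {mpoly R[n]}.

Lemma mmap_mpolyX p : mmap (@mpolyC n R) (fun i => 'X_i) p = p.
Proof.
rewrite {2}[p]mpolyE; apply: eq_bigr => m _.
by rewrite mul_mpolyC /mmap1 -mpolyXE_id.
Qed.

Lemma mmap_mpolyC (S : comNzRingType) (f : {rmorphism R -> S}) p (v : 'I_n -> R) :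
  mmap f (fun i => f (v i)) p = f p.@[v].
Proof.
rewrite mevalE rmorph_sum; apply: eq_bigr => m _; rewrite rmorphM rmorph_prod.
by congr (_ * _); apply: eq_bigr => i _; rewrite rmorphXn.
Qed.

Lemma mmap_homog_line (S : comNzRingType) (f : {rmorphism R -> S}) d p c
    (v : 'I_n -> R) : p \is d.-homog ->
  mmap f (fun i => c * f (v i)) p = c ^+ d * f p.@[v].
Proof. by move=> hp; rewrite (mmap_homog _ _ _ hp) mmap_mpolyC. Qed.

Lemma meval_homog d p c (v : 'I_n -> R) : p \is d.-homog ->
  p.@[fun i => c * v i] = c ^+ d * p.@[v].
Proof. exact: (mmap_homog_line idfun). Qed.

End Evaluation.

(** * The projective Nullstellensatz *)

Section Nullstellensatz.

Variables (n : nat) (k : closedFieldType).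
Local Notation S := {mpoly k[n]}.
Implicit Types (J : S -> Prop) (p q : S).

Lemma cut_empty0P J : ideal J -> cut_empty 0 J <-> exists s, mpow s J.
Proof.
move=> iJ; split=> [[L [s ms]]|[s ms]].
  by exists s.+1 => m /ms [g]; rewrite big_ord0 subr0.
exists 0, s => m ms'; apply: adj_sub; exact: (mpow_leq iJ ms (leqnSn s)).
Qed.

Section MaximalIdeal.

Variables (J : S -> Prop) (mJ : max_uncut 0 J) (i0 : 'I_n).
Hypothesis Ji0 : ~ J 'X_i0.
Let x0 : S := 'X_i0.

Let hJ : hideal J. Proof. by case: mJ. Qed.
Let iJ : ideal J. Proof. by case: hJ. Qed.

Let homX (i : 'I_n) : ('X_i : S) \is 1.-homog.
Proof. by rewrite dhomogX /= mdeg1. Qed.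

Let homXX (i : 'I_n) e : ('X_i ^+ e : S) \is e.-homog.
Proof. by have := dhomogMn e (homX i); rewrite mul1n. Qed.

Lemma max_uncut_1 : ~ J 1.
Proof.
case: mJ => _ nJ _ J1; apply: nJ; exists 0, 0%N => m _; apply: adj_sub.
by rewrite -['X_[m]]mulr1; apply: idealM.
Qed.

Lemma max_uncut_x0M e d p : p \is d.-homog -> J (x0 ^+ e * p) -> J p.
Proof.
move=> hp; elim: e => [|e IH]; first by rewrite mul1r.
rewrite exprS -mulrA => Jp.
by have [|/IH] := max_uncut_prime mJ (homX i0) (dhomogM (homXX i0 e) hp) Jp.
Qed.

(** By maximality J + (x0) contains all forms of degree above [s], so modulo [J] such a form is
    divisible by [x0], repeatedly until degree [s]. This bounds the dimension of S/J in all large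
    degrees. *)
Lemma max_uncut_quotient : exists s, forall M f, f \is (M + s).-homog ->
  exists2 p, p \is s.-homog & J (f - x0 ^+ M * p).
Proof.
have [L [s ms]] := max_uncut_adj_one mJ (homX i0) Ji0.
have {L}ms : mpow s.+1 (adj_one J x0) by move=> m /ms [g]; rewrite big_ord0 subr0.
exists s; elim=> [|M IH] f hf.
  by exists f => //; rewrite mul1r subrr; apply: ideal0.
have i1 : ideal (adj_one J x0) by apply: ideal_adj.
have ms' : mpow (M + s).+1 (adj_one J x0) by apply: mpow_leq ms _ => //; lia.
have Jf : adj_one J x0 f by apply: mpow_homog ms' _.
have [//|g [hg Jg]] := adj_homog1 hJ _ hf Jf; first by move=> _; apply: homX.
have [p hp Jp] := IH _ (hg ord0); exists p => //.
rewrite big_ord1 in Jg; apply: (idealBK iJ _ (idealM x0 iJ Jp)).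
by rewrite exprS; congr (J _): Jg; ring.
Qed.

Variable j : 'I_n.

(** The homogenization x0^M q(x_j / x0), for [q] of degree at most [M]. *)
Definition bin_form M (q : {poly k}) : S :=
  \sum_(i < M.+1) q`_i *: ('X_j ^+ i * x0 ^+ (M - i)).

Lemma bin_form_homog M (q : {poly k}) : bin_form M q \is M.-homog.
Proof.
apply: rpred_sum => i _; apply: rpredZ.
have := dhomogM (homXX j i) (homXX i0 (M - i)).
by rewrite subnKC // -ltnS.
Qed.

Lemma bin_formS M (q : {poly k}) : (size q <= M.+1)%N ->
  bin_form M.+1 q = x0 * bin_form M q.
Proof.
move=> sq; rewrite /bin_form big_ord_recr /= nth_default // scale0r addr0.
rewrite mulr_sumr; apply: eq_bigr => i _; rewrite -scalerAr subSn; last first.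
  by rewrite -ltnS.
by rewrite exprS mulrCA.
Qed.

Lemma bin_formMX M (q : {poly k}) : bin_form M.+1 ('X * q) = 'X_j * bin_form M q.
Proof.
rewrite /bin_form big_ord_recl /= coefXM eqxx scale0r add0r mulr_sumr.
apply: eq_bigr => i _; rewrite coefXM /= subSS -scalerAr exprS mulrA.
by [].
Qed.

(** A root c of [q] splits off the factor x_j - c x0, and primality of [J] puts it or the form of
    the cofactor into [J]. A drop in the degree of [q] is a factor [x0], which can be cancelled; at
    [M = 0] a nonzero constant would lie in [J]. *)
Lemma bin_form_root M (q : {poly k}) :
  q != 0 -> (size q <= M.+1)%N -> J (bin_form M q) ->
  exists c, J ('X_j - c *: x0).
Proof.
elim: M q => [|M IH] q q0 sq Jq.
  have [c E] : exists c, q = c%:P by exists q`_0; apply: size1_polyC.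
  case: max_uncut_1; move: Jq q0; rewrite /bin_form big_ord1 E coefC /= mulr1.
  rewrite polyC_eq0 => Jc c0.
  by rewrite -[1](scalerK c0) -mul_mpolyC; apply: idealM.
have [sq'|] := leqP (size q) M.+1.
  apply: (IH q) => //; apply: (@max_uncut_x0M 1 M); first exact: bin_form_homog.
  by rewrite expr1 -bin_formS.
move=> sq'; have {sq' sq} sq : size q = M.+2 by apply/eqP; rewrite eqn_leq sq.
have /closed_rootP [c /factor_theorem [q' E]] : size q != 1%N by rewrite sq.
have q'0 : q' != 0 by apply: contraNneq q0 => q'0; rewrite E q'0 mul0r.
have sq' : size q' = M.+1.
  by move: sq; rewrite E size_Mmonic ?monicXsubC // size_XsubC addn2 => -[].
have BE : bin_form M.+1 q = ('X_j - c *: x0) * bin_form M q'.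
  rewrite mulrBl -bin_formMX -scalerAl -bin_formS ?sq' //.
  rewrite E mulrC mulrBl mul_polyC /bin_form scaler_sumr -sumrB.
  by apply: eq_bigr => i _; rewrite coefB coefZ scalerBl scalerA.
rewrite BE in Jq; have hc : 'X_j - c *: x0 \is 1.-homog.
  exact: rpredB (homX j) (rpredZ c (homX i0)).
have [|/IH] := max_uncut_prime mJ hc (bin_form_homog M q') Jq.
  by exists c.
by apply; rewrite ?sq'.
Qed.

(** Modulo [J] the K + s + 1 monomials of degree K + s in x_j and x0 are x0^K times forms of degree
    [s]. These forms span a space of dimension at most [K], so some nonzero binary form lies in
    [J]. *)
Lemma max_uncut_ratio : exists c, J ('X_j - c *: x0).
Proof.
have [s Hs] := max_uncut_quotient.
pose K := #|{: mon_of_deg n s}|; pose M := (K + s)%N.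
have /fin_all_exists2 [p hp Jp] (i : 'I_M.+1) : exists2 p, p \is s.-homog &
    J ('X_j ^+ i * x0 ^+ (M - i) - x0 ^+ K * p).
  apply: Hs; have := dhomogM (homXX j i) (homXX i0 (M - i)).
  by rewrite subnKC // -ltnS.
pose C := \matrix_(i, l) (p i)@_(@mon n s l).
have : kermx C != 0.
  rewrite -mxrank_eq0 mxrank_ker subn_eq0 -ltnNge.
  by apply: leq_ltn_trans (rank_leq_col _) _; rewrite /M -/K; lia.
case/rowV0Pn => c /sub_kermxP cC c0.
apply: (@bin_form_root M (\poly_(i < M.+1) c 0 (inord i))).
- apply: contraNneq c0 => q0; apply/eqP/rowP => i; rewrite mxE.
  by have := congr1 (fun q : {poly k} => q`_i) q0;
    rewrite coef_poly ltn_ord inord_val coef0.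
- exact: size_poly.
have : J (\sum_(i < M.+1) c 0 i *: ('X_j ^+ i * x0 ^+ (M - i) - x0 ^+ K * p i)).
  by apply: ideal_sum => // i _; rewrite -mul_mpolyC; apply: idealM.
under eq_bigr do rewrite scalerBr; rewrite sumrB.
under [X in _ - X]eq_bigr do rewrite scalerAr; rewrite -mulr_sumr.
rewrite [X in _ * X](_ : _ = 0) ?mulr0 ?subr0.
  congr J; apply: eq_bigr => i _; rewrite coef_poly ltn_ord inord_val //.
under eq_bigr => i _ do rewrite (homog_monE (hp i)) scaler_sumr.
rewrite exchange_big big1 //= => l _; under eq_bigr do rewrite scalerA.
rewrite -scaler_suml; have /matrixP/(_ 0 l) := cC; rewrite !mxE => E.
rewrite (_ : \sum_i _ = 0) ?scale0r // -[RHS]E.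
by apply: eq_bigr => i _; rewrite mxE.
Qed.

End MaximalIdeal.

(** The ratios c_i modulo a maximal [J1] containing [J] are the coordinates of a zero: a form q of
    degree d is congruent to q(c) x0^d, so if q lies in [J1] and q(c) <> 0, then x0^d lies in [J1],
    and cancelling [x0] puts 1 there. *)
Theorem projective_nullstellensatz J : hideal J -> (forall s, ~ mpow s J) ->
  exists2 v : 'rV[k]_n, v != 0 & forall p, J p -> p.@[v 0] = 0.
Proof.
move=> hJ0 nJ0; have /(max_uncut_exists hJ0) [J1 mJ J01] : ~ cut_empty 0 J.
  by move=> /cut_empty0P [|s ms]; [case: hJ0 | apply: nJ0 ms].
have [hJ nJ _] := mJ; have [iJ _] := hJ.
have [i0 Ji0] : exists i0 : 'I_n, ~ J1 'X_i0.
  apply: boolp.contrapT => /boolp.forallNP H; apply: nJ; exists 0, 0%N => m.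
  move=> /eqP /mdeg1P [i /eqP ->]; apply: adj_sub.
  exact: boolp.contrapT (H i).
have /fin_all_exists [c Hc] i := max_uncut_ratio mJ Ji0 i.
have c0 : c i0 != 0.
  apply/eqP => ci0; apply: Ji0; have := Hc i0; rewrite ci0 scale0r subr0 //.
exists (\row_i c i) => [|p /J01 Jp].
  by apply: contraNneq c0 => /rowP/(_ i0); rewrite !mxE => ->.
rewrite (_ : meval _ p = p.@[c]); last by apply: meval_eq => i; rewrite mxE.
rewrite [p](pihomog_partitionE (leqnn (mmeasure mdeg p))) raddf_sum big1 //=.
move=> d _; set q := pihomog _ _ _.
have hq : q \is d.-homog. by apply: pihomogP.
have Jq : J1 q by case: hJ => _; apply.
apply/eqP; apply: boolp.contrapT => /negP qc; apply: (max_uncut_1 mJ).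
apply: (@max_uncut_x0M J1 mJ i0 Ji0 d 0); first exact: dhomog1.
rewrite mulr1 -[_ ^+ _](scalerK qc) -mul_mpolyC; apply: idealM => //.
rewrite -mul_mpolyC mulrC -(mmap_homog_line _ _ _ hq) -[X in J1 X](subKr q).
apply: idealB => //; rewrite -[X in J1 (X - _)]mmap_mpolyX.
apply: ideal_congr_mmap => // i.
by rewrite mulrC mul_mpolyC.
Qed.

End Nullstellensatz.

(** * Vanishing ideals of subsets of projective space *)

Section VanishingIdeals.

Variables (k : closedFieldType) (n : nat).
Local Notation S := {mpoly k[n.+1]}.
Implicit Types (C W : pset k n) (p q : S).

(* A polynomial is required to vanish on the lines spanned by the points of C,
   so that its homogeneous components vanish at these points. *)
Definition vanish C p :=
  forall v, C v -> mmap (@polyC k) (fun i => 'X * (v 0 i)%:P) p = 0.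

Lemma ideal_vanish C : ideal (vanish C).
Proof.
split=> [v _|p q Cp Cq v Cv|p q Cq v Cv]; first by rewrite rmorph0.
  by rewrite rmorphD /= Cp // Cq // addr0.
by rewrite rmorphM /= Cq // mulr0.
Qed.

Lemma vanish_homogP C d p : p \is d.-homog ->
  vanish C p <-> forall v, C v -> p.@[v 0] = 0.
Proof.
move=> hp; split=> Cp v Cv; have := mmap_homog_line (@polyC k) 'X (v 0) hp.
  rewrite Cp // => /esym/eqP.
  by rewrite mulf_eq0 expf_eq0 polyX_eq0 andbF polyC_eq0 => /eqP.
by rewrite Cp // mulr0.
Qed.

Lemma hideal_vanish C : hideal (vanish C).
Proof.
split; first exact: ideal_vanish.
move=> d p Cp; apply/(vanish_homogP C (pihomogP mdeg d p)) => v /Cp.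
have [lt|ge] := ltnP d (mmeasure mdeg p); last first.
  by rewrite pihomog_ge ?meval0.
rewrite {1}[p](pihomog_partitionE (leqnn (mmeasure mdeg p))) rmorph_sum /=.
under eq_bigr do rewrite (mmap_homog_line _ _ _ (pihomogP _ _ _)).
move=> /(congr1 (fun q : {poly k} => q`_d)); rewrite coef0 coef_sum.
rewrite (bigD1 (Ordinal lt)) //= big1 ?addr0 => [|i ne].
  by rewrite coefMC coefXn eqxx mul1r.
by rewrite coefMC coefXn eq_sym -val_eqE /= in ne *; rewrite (negbTE ne) mul0r.
Qed.

Definition pzeros p : pset k n := fun v => v != 0 /\ p.@[v 0] = 0.

Lemma closed_zeros d p : p \is d.-homog ->
  closed_in (@pspace k n) (pzeros p).
Proof.
move=> hp; exists (pzeros p).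
split=> [|v]; last by split=> [vz|[]//]; case: (vz).
exists (fun q => q = p); split=> [q ->|v]; first by exists d.
split=> [[v0 pv]|[v0 H]]; split=> //; first by move=> q ->.
exact: H.
Qed.

Lemma vanish_prime C d e p q : irreducible_in (@pspace k n) C ->
  p \is d.-homog -> q \is e.-homog -> vanish C (p * q) ->
  vanish C p \/ vanish C q.
Proof.
move=> [[C' [_ CE]] _ irC] hp hq /(vanish_homogP C (dhomogM hp hq)) Cpq.
have C0 v : C v -> v != 0 by move/CE => [].
have [v Cv|H|H] := irC _ _ (closed_zeros hp) (closed_zeros hq).
- move/eqP: (Cpq _ Cv); rewrite mevalM mulf_eq0.
  by move=> /orP [/eqP|/eqP] E; [left|right]; split=> //; apply: C0.
- by left; apply/(vanish_homogP C hp) => v /H [].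
- by right; apply/(vanish_homogP C hq) => v /H [].
Qed.

Lemma vanish_sub C W p : psubset W C -> vanish C p -> vanish W p.
Proof. by move=> WC Cp v /WC/Cp. Qed.

(** One of the homogeneous equations that define [W] must fail somewhere on [C]. *)
Lemma closed_in_separate C W : closed_in (@pspace k n) W ->
  psubset C (@pspace k n) -> ~ psubset C W ->
  exists d f, [/\ f \is d.-homog, vanish W f & ~ vanish C f].
Proof.
move=> [W' [[F [hF W'E]] WE]] C0 nCW; apply: boolp.contrapT => nf.
apply: nCW => v Cv; apply/WE; split; first exact: C0.
apply/W'E; split=> [|p Fp]; first exact: C0 Cv.
have [d hp] := hF _ Fp; apply: boolp.contrapT => pv; apply: nf.
exists d, p; split=> //; last by move/(vanish_homogP C hp)/(_ _ Cv).
by apply/(vanish_homogP W hp) => w /WE [_ /W'E [_]]; apply.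
Qed.

End VanishingIdeals.

(** * Substitution of linear forms respects the grading *)

Section LinearSubstitution.

Variables (r n : nat) (k : fieldType).
Implicit Type c : {mpoly k[r]}.

Lemma mmap_homog_forms (h : 'I_r -> {mpoly k[n]}) d c :
  (forall i, h i \is 1.-homog) -> c \is d.-homog ->
  mmap (@mpolyC n k) h c \is d.-homog.
Proof.
move=> hh /dhomogP hc; rewrite /mmap big_seq; apply: rpred_sum => m mc.
rewrite mul_mpolyC; apply: rpredZ; have /= <- := hc _ mc; rewrite /mmap1 mdegE.
elim/big_rec2: _ => [|i y x _ hx]; first exact: dhomog1.
apply: dhomogM => //; have := dhomogMn (m i) (hh i); by rewrite mul1n.
Qed.

Lemma pihomog_mmap_forms (h : 'I_r -> {mpoly k[n]}) d c :
  (forall i, h i \is 1.-homog) ->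
  pihomog mdeg d (mmap (@mpolyC n k) h c) =
  mmap (@mpolyC n k) h (pihomog mdeg d c).
Proof.
move=> hh; have [lt|ge] := ltnP d (mmeasure mdeg c).
  rewrite {1}[c](pihomog_partitionE (leqnn (mmeasure mdeg c))) rmorph_sum /=.
  rewrite (raddf_sum (pihomog mdeg d)) (bigD1 (Ordinal lt)) //=.
  rewrite pihomog_dE; last by apply: mmap_homog_forms => //; apply: pihomogP.
  rewrite [X in _ + X]big1 ?addr0 // => i ne; apply: (@pihomog_ne0 _ _ _ i) => //.
  by apply: mmap_homog_forms => //; apply: pihomogP.
rewrite (pihomog_ge ge) rmorph0.
rewrite {1}[c](pihomog_partitionE (leqnn (mmeasure mdeg c))) rmorph_sum /=.
rewrite (raddf_sum (pihomog mdeg d)) big1 //= => i _.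
apply: (@pihomog_ne0 _ _ _ i); last first.
  by apply: mmap_homog_forms => //; apply: pihomogP.
by rewrite ltn_eqF // (leq_trans (ltn_ord i)).
Qed.

End LinearSubstitution.

(** * Noether normalization of an irreducible closed set *)

Section DimensionDrop.

Variables (k : closedFieldType) (n r : nat).
Local Notation S := {mpoly k[n.+1]}.
Variables (C : pset k n) (L : 'M[k]_(r, n.+1)) (s : nat).
Hypothesis irC : irreducible_in (@pspace k n) C.
Local Notation I := (vanish C).
Hypothesis cutC : mpow s.+1 (adj I (lform L)).

Let hI : hideal I. Proof. exact: hideal_vanish. Qed.
Let iI : ideal I. Proof. by case: hI. Qed.

Local Notation ev := (mmap (@mpolyC n.+1 k) (lform L)).
Let K := #|{: 'X_{1..n.+1 < s.+1}}|.
Let b (i : 'I_K) : 'X_{1..n.+1} := bmnm (enum_val i).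

Let low_expand (g : S) : (msize g <= s.+1)%N ->
  g = \sum_i ev (g@_(b i))%:MP * 'X_[b i].
Proof.
move=> hg; rewrite {1}[g](mpolywE hg) (reindex (fun i : 'I_K => enum_val i)) /=;
  last first.
  exact: onW_bij (@enum_val_bij _).
by apply: eq_bigr => i _; rewrite mmapC mul_mpolyC.
Qed.

(** Graded Nakayama: in degree above [s] a form is, modulo the ideal of [C], a combination of the
    linear forms with coefficients of degree one less, to which the induction applies. *)
Lemma module_generators_homog D (g : S) : g \is D.-homog ->
  exists c : 'I_K -> {mpoly k[r]}, I (g - \sum_i ev (c i) * 'X_[b i]).
Proof.
have low D' (g' : S) : g' \is D'.-homog -> (D' <= s)%N ->
    exists c : 'I_K -> {mpoly k[r]}, I (g' - \sum_i ev (c i) * 'X_[b i]).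
  move=> /dhomogP hg lt; exists (fun i => (g'@_(b i))%:MP).
  rewrite -low_expand ?subrr; first exact: ideal0.
  by rewrite msizeE; apply/bigmax_leqP_seq => m mg _; rewrite ltnS (hg _ mg).
elim: D g => [|D IH] g hg; first by apply: low hg _.
have [lt|ge] := leqP D.+1 s; first by apply: low hg lt.
have Lg : adj I (lform L) g.
  have iL := ideal_adj (lform L) iI; apply: (mpow_homog iL _ hg).
  exact: (mpow_leq iL cutC).
have [h [hh Ih]] := adj_homog1 hI (lform_homog L) hg Lg.
have /fin_all_exists [c Hc] a := IH _ (hh a).
exists (fun i => \sum_a c a i * 'X_a).
have -> : \sum_i ev (\sum_a c a i * 'X_a) * 'X_[b i] =
    \sum_a lform L a * \sum_i ev (c a i) * 'X_[b i].
  under eq_bigr do rewrite rmorph_sum mulr_suml; rewrite exchange_big /=.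
  apply: eq_bigr => a _; rewrite mulr_sumr; apply: eq_bigr => i _.
  by rewrite rmorphM /= mmapX mmap1U mulrAC mulrC.
have Ic : I (\sum_a lform L a * (h a - \sum_i ev (c a i) * 'X_[b i])).
  by apply: ideal_sum => // a _; apply: (idealM _ iI (Hc a)).
have := idealD iI Ih Ic; congr I.
under [X in _ + X]eq_bigr do rewrite mulrBr; rewrite sumrB addrA.
by congr (_ - _); under [X in _ + X]eq_bigr do rewrite mulrC; rewrite subrK.
Qed.

Lemma module_generators (g : S) :
  exists c : 'I_K -> {mpoly k[r]}, I (g - \sum_i ev (c i) * 'X_[b i]).
Proof.
have /fin_all_exists [c Hc] (d : 'I_(mmeasure mdeg g)) :=
  module_generators_homog (pihomogP mdeg d g).
exists (fun i => \sum_d c d i).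
rewrite {1}[g](pihomog_partitionE (leqnn (mmeasure mdeg g))).
under [X in _ - X]eq_bigr do rewrite rmorph_sum mulr_suml.
by rewrite exchange_big -sumrB; apply: (ideal_sum _ iI) => d _; apply: Hc.
Qed.

(** Determinant trick: multiplication by [f] acts on the generators through a matrix [M] over k[r],
    and multiplying by the adjugate of f - M gives det(f - M) times each generator, one of which is
    1. *)
Lemma integral_equation (f : S) :
  exists2 P : {poly {mpoly k[r]}}, P \is monic & I (\sum_(i < size P) ev P`_i * f ^+ i).
Proof.
have /fin_all_exists [c Hc] (i : 'I_K) := module_generators (f * 'X_[b i]).
pose M := \matrix_(i, j) c i j; exists (char_poly M); first exact: char_poly_monic.
pose N := f%:M - map_mx ev M.
have -> : \sum_(i < size (char_poly M)) ev (char_poly M)`_i * f ^+ i = \det N.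
  transitivity (map_poly ev (char_poly M)).[f].
    rewrite /map_poly (horner_coef_wide _ (size_poly _ _)).
    by apply: eq_bigr => i _; rewrite coef_poly ltn_ord.
  rewrite -horner_evalE /char_poly -!det_map_mx; congr (\det _).
  apply/matrixP => i j; rewrite !mxE /horner_eval rmorphB /= map_polyC /=.
  by rewrite raddfMn /= map_polyX /horner_eval hornerD hornerN hornerC hornerMn hornerX.
have [i0 bi0] : exists i0, b i0 = 0%MM.
  by exists (enum_rank (@bm0 n.+1 s)); rewrite /b enum_rankK.
have -> : \det N = \sum_i (\adj N) i0 i * \sum_j N i j * ('X_[b j] : S).
  under [RHS]eq_bigr do rewrite mulr_sumr; rewrite exchange_big /=.
  under [RHS]eq_bigr => j _.
    under eq_bigr do rewrite mulrA.
    rewrite -mulr_suml (_ : \sum_i _ = (\adj N *m N) i0 j); last by rewrite mxE.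
    rewrite mul_adj_mx mxE; over.
  rewrite (bigD1 i0) //= eqxx bi0 mpolyX0 mulr1 big1 ?addr0 // => j.
  by rewrite eq_sym => /negbTE ->; rewrite mulr0n mul0r.
apply: (ideal_sum _ iI) => i _; apply: (idealM _ iI); congr (I _): (Hc i).
under [RHS]eq_bigr do rewrite !mxE mulrBl; rewrite sumrB; congr (_ - _).
rewrite (bigD1 i) //= eqxx mulr1n big1 ?addr0 // => j.
by rewrite eq_sym => /negbTE ->; rewrite mulr0n mul0r.
Qed.

(** The coefficients of the integral equation are replaced by their components of the degree that
    makes it homogeneous; the leading 1 survives. While the constant coefficient is 0, a factor [f]
    is cancelled, the ideal of [C] being prime; the first nonzero constant coefficient is then a
    multiple of [f]. *)
Lemma algebraic_relation e (f : S) : f \is e.-homog -> ~ I f ->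
  exists E (c : {mpoly k[r]}) g,
    [/\ c \is E.-homog, c != 0 & I (ev c - g * f)].
Proof.
move=> hf nf; have [P mP IP] := integral_equation f.
have [N sP] : exists N, size P = N.+1.
  by exists (size P).-1; rewrite prednK // size_poly_gt0 monic_neq0.
pose c i := pihomog mdeg (e * (N - i)) P`_i.
have hc i : c i \is (e * (N - i)).-homog by apply: pihomogP.
have cN : c N != 0.
  rewrite /c subnn muln0; move/monicP: mP; rewrite lead_coefE sP => ->.
  by rewrite pihomog_dE ?oner_neq0 ?dhomog1.
have Ic : I (\sum_(i < N.+1) ev (c i) * f ^+ i).
  case: hI => _ /(_ (e * N)%N _ IP); rewrite sP (raddf_sum (pihomog _ _)) /=.
  congr (I _); apply: eq_bigr => i _.
  have iN : (i <= N)%N by rewrite -ltnS.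
  rewrite mulrC -{1}(subnKC iN) mulnDr (pihomogMl _ _ (dhomogMn i hf)) mulrC.
  by rewrite pihomog_mmap_forms //; apply: lform_homog.
elim: N c hc cN Ic {sP} => [|N IH] c hc cN Ic.
  exists 0%N, (c 0%N), 0; split=> //; first by have := hc 0%N; rewrite muln0.
  by move: Ic; rewrite big_ord1 mulr1 mul0r subr0.
have [c0|c0] := eqVneq (c 0%N) 0; last first.
  exists (e * N.+1)%N, (c 0%N), (- \sum_(i < N.+1) ev (c i.+1) * f ^+ i).
  split; [by have := hc 0%N; rewrite subn0 | by [] |].
  congr (I _): Ic; rewrite big_ord_recl mulr1 mulNr opprK mulr_suml.
  by congr (_ + _); apply: eq_bigr => i _; rewrite exprSr mulrA.
apply: (IH (fun i => c i.+1)) => //.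
have hs : \sum_(i < N.+1) ev (c i.+1) * f ^+ i \is (e * N)%N.-homog.
  apply: rpred_sum => i _; have iN : (i <= N)%N by rewrite -ltnS.
  have := dhomogM (mmap_homog_forms (lform_homog L) (hc i.+1)) (dhomogMn i hf).
  by rewrite subSS -mulnDr subnK.
have [//|//|//] := vanish_prime irC hf hs _.
congr (I _): Ic; rewrite big_ord_recl c0 rmorph0 mul0r add0r mulr_sumr.
by apply: eq_bigr => i _; rewrite exprS mulrCA.
Qed.

End DimensionDrop.

(** * From codimension to empty linear sections *)

Lemma vanish_eval (k : closedFieldType) n (C : pset k n) p v :
  vanish C p -> C v -> p.@[v 0] = 0.
Proof.
move=> Cp Cv; rewrite [p](pihomog_partitionE (leqnn (mmeasure mdeg p))).
rewrite raddf_sum big1 //= => d _.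
have [_ /(_ d _ Cp)] := hideal_vanish C.
by move/(vanish_homogP C (pihomogP mdeg d p)); apply.
Qed.

Section CodimensionToForms.

Variables (k : closedFieldType) (n : nat).
Local Notation S := {mpoly k[n.+1]}.
Implicit Types (J : S -> Prop) (C W : pset k n).

Lemma cut_empty_mono r J J' :
  (forall p, J p -> J' p) -> cut_empty r J -> cut_empty r J'.
Proof.
by move=> JJ' [L [s ms]]; exists L, s => m /ms; apply: adj_mono.
Qed.

(** A monomial of degree [t * E] is a product of [E] monomials of degree [t], each a multiple of [g]
    modulo [J]. *)
Lemma mpow_of_power J (g : S) E t : ideal J -> mpow t (adj_one J g) ->
  J (g ^+ E) -> mpow (t * E)%N J.
Proof.
move=> iJ mt JE m md.
have [h Jh] : exists h, J ('X_[m] - h * g ^+ E).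
  elim: E m md {JE} => [|E IH] m md.
    by exists 'X_[m]; rewrite mulr1 subrr; apply: ideal0.
  have [|m1 [m2 [Em d1]]] := @mdeg_split _ m t; first by rewrite md mulnS leq_addr.
  move: md; rewrite Em mdegD d1 mulnS => /addnI /IH [h2 J2].
  have /adj_oneP [h1 J1] := mt _ d1; exists (h1 * h2).
  by rewrite mpolyXD exprS mulrACA; apply: ideal_congrM.
exact: (idealBK iJ Jh (idealM _ iJ JE)).
Qed.

(* Noether normalization makes C finite over k[l], so that an equation of W not
   vanishing on C yields a nonzero c(l) vanishing on W.  Replacing the forms l
   by those vanishing at a point p with c(p) <> 0 makes W finite over one form
   less. *)
Lemma cut_empty_drop r C W : irreducible_in (@pspace k n) C ->
  closed_in (@pspace k n) W -> psubset W C -> ~ psubset C W ->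
  cut_empty r.+1 (vanish C) -> cut_empty r (vanish W).
Proof.
move=> irC clW WC nCW [L [s ms]].
have C0 : psubset C (@pspace k n).
  by move=> v; case: irC => [[? [_ CE]] _ _] /CE [].
have [e [f [hf Wf nCf]]] := closed_in_separate clW C0 nCW.
have [E [c [g [hc cn0 Ic]]]] := algebraic_relation irC ms hf nCf.
have iW : ideal (vanish W) by apply: ideal_vanish.
have Wc : vanish W (mmap (@mpolyC n.+1 k) (lform L) c).
  exact: (idealBK iW (vanish_sub WC Ic) (idealM _ iW Wf)).
(* The extra variable makes the first coordinate of [p] nonzero too, so that the remaining forms can
   be corrected by multiples of the first one. *)
have : c * 'X_ord0 != 0.
  by rewrite mulf_neq0 // -msize_poly_eq0 msizeX.
move=> /mpoly_nonzero_point [p]; rewrite mevalM mevalXU mulf_eq0 negb_or.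
move=> /andP [cp p0].
pose L' : 'M[k]_(r, n.+1) :=
  \matrix_(j, i) (L (lift ord0 j) i - p (lift ord0 j) / p ord0 * L ord0 i).
set l0 := lform L ord0; pose J := adj (vanish W) (lform L').
have iJ : ideal J by apply: ideal_adj.
have L'E j : lform L' j = lform L (lift ord0 j) - l0 * (p (lift ord0 j) / p ord0)%:MP.
  rewrite mulrC mul_mpolyC /l0 /lform scaler_sumr -sumrB; apply: eq_bigr => i _.
  by rewrite mxE scalerBl scalerA.
have JL a : J (lform L a - l0 * (p a / p ord0)%:MP).
  case: (unliftP ord0 a) => [j ->|->]; first by rewrite -L'E; apply: adj_gen.
  by rewrite divff // mulr1 subrr; apply: ideal0.
have cp' : c.@[fun a => p a / p ord0] != 0.
  rewrite (@meval_eq _ _ _ (fun a => (p ord0)^-1 * p a)); last first.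
    by move=> a; rewrite mulrC.
  by rewrite (meval_homog _ _ hc) mulf_neq0 // expf_neq0 // invr_eq0.
(* Modulo [J] the forms are the multiples (p_a / p_0) l0 of [l0], so c(l), which vanishes on [W], is
   congruent to c(p / p_0) l0^E. *)
have Jl0 : J (l0 ^+ E).
  rewrite -[_ ^+ _](scalerK cp') -mul_mpolyC; apply: (idealM _ iJ).
  rewrite -mul_mpolyC mulrC -(mmap_homog_line (@mpolyC n.+1 k) _ _ hc).
  rewrite -[X in J X](subKr (mmap (@mpolyC n.+1 k) (lform L) c)).
  apply: (idealB iJ); first exact: adj_sub.
  exact: ideal_congr_mmap.
have ml0 : mpow s.+1 (adj_one J l0).
  have iJ0 : ideal (adj_one J l0) by apply: ideal_adj.
  move=> m /ms; apply: (adj_min iJ0) => [q Cq|a].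
    by do 2![apply: adj_sub]; apply: vanish_sub Cq.
  by apply/adj_oneP; exists (p a / p ord0)%:MP; rewrite mulrC.
exists L', (s.+1 * E)%N; apply: (mpow_leq iJ _ (leqnSn _)).
exact: mpow_of_power ml0 Jl0.
Qed.

Lemma cut_empty_all J : ideal J -> cut_empty n.+1 J.
Proof.
move=> iJ; exists 1%:M, 0%N => m /eqP /mdeg1P [i /eqP ->].
have -> : 'X_i = lform 1%:M i :> S; last exact: adj_gen.
rewrite /lform (bigD1 i) //= mxE eqxx scale1r big1 ?addr0 // => j.
by rewrite mxE eq_sym => /negbTE ->; rewrite scale0r.
Qed.

Lemma nullstellensatz_adj r J (L : 'M[k]_(r, n.+1)) : hideal J ->
  (forall s, ~ mpow s (adj J (lform L))) ->
  exists2 v : 'rV[k]_n.+1, v != 0 &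
    (forall p, J p -> p.@[v 0] = 0) /\ forall i, (lform L i).@[v 0] = 0.
Proof.
move=> hJ /(projective_nullstellensatz (hideal_adj_lform L hJ)) [v v0 Jv].
exists v => //; split=> [p Jp|i]; apply: Jv; first exact: adj_sub.
by apply: adj_gen; case: hJ.
Qed.

(** Otherwise [J] lies in a maximal uncut [J1], whose zero locus [W] is irreducible. All n + 1
    coordinates cut the top of the chain above [W] down to the empty set, and each of the [c] steps
    down saves one form, leaving [r] forms for [W]: a contradiction. *)
Theorem codim_ge_cut_empty r c J : hideal J -> (r + c)%N = n.+1 ->
  (forall W, irreducible_in (@pspace k n) W ->
    (forall v p, W v -> J p -> p.@[v 0] = 0) ->
    exists C : nat -> pset k n,
      [/\ psame (C 0%N) W,
          forall i, (i <= c)%N -> irreducible_in (@pspace k n) (C i) &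
          forall i, (i < c)%N ->
            psubset (C i) (C i.+1) /\ ~ psubset (C i.+1) (C i)]) ->
  cut_empty r J.
Proof.
move=> hJ0 rc chains; apply: boolp.contrapT => nJ0.
have [J1 mJ J01] := max_uncut_exists hJ0 nJ0; have [hJ nJ maxJ] := mJ.
have iJ : ideal J1 by case: hJ.
pose W : pset k n := fun v => v != 0 /\ forall p, J1 p -> p.@[v 0] = 0.
have J1W p : J1 p -> vanish W p.
  have hq d : pihomog mdeg d p \is d.-homog by apply: pihomogP.
  move=> J1p; rewrite [p](pihomog_partitionE (leqnn (mmeasure mdeg p))).
  apply: (ideal_sum _ (ideal_vanish W)) => d _.
  apply/(vanish_homogP W (hq d)) => v [_]; apply; by case: hJ => _; apply.
(* By the Nullstellensatz, if no power of the irrelevant ideal lies in J1 + (L), there is a point of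
   [W] on which [L] vanishes; powers of the coordinates lying in I(W) + (L) would all vanish
   there. *)
have nW : ~ cut_empty r (vanish W).
  move=> [L [s ms]]; apply: nJ; exists L.
  apply: boolp.contrapT => /boolp.forallNP nms.
  have [|v v0 [Jv Lv]] := nullstellensatz_adj (L := L) hJ.
    move=> t mt; apply: (nms t).
    exact: (mpow_leq (ideal_adj _ iJ) mt (leqnSn t)).
  have Wv : W v by split.
  case/negP: v0; apply/eqP/rowP => i; rewrite mxE; apply/eqP.
  have [|g Wg] := ms (U_(i) *+ s.+1)%MM; first by rewrite mdegMn mdeg1 mul1n.
  move: (vanish_eval Wg Wv); rewrite mevalB.
  have -> : (\sum_a g a * lform L a).@[v 0] = 0.
    by rewrite raddf_sum big1 //= => a _; rewrite mevalM Lv mulr0.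
  by rewrite subr0 -mpolyXn rmorphXn /= mevalXU => /eqP; rewrite expf_eq0.
have WJ1 : forall p, vanish W p -> J1 p by apply: maxJ => //; apply: hideal_vanish.
have irW : irreducible_in (@pspace k n) W.
  split.
  - exists W; split=> [|v]; last by split=> [Wv|[]//]; case: (Wv).
    exists (fun p => J1 p /\ exists d, p \is d.-homog); split=> [p []//|v].
    split=> [[v0 Jv]|[v0 H]]; first by split=> // p [/Jv].
    split=> // p J1p; rewrite [p](pihomog_partitionE (leqnn (mmeasure mdeg p))).
    rewrite raddf_sum big1 //= => d _; apply: H; split; last first.
      by exists d; apply: pihomogP.
    by case: hJ => _; apply.
  - have [s ms|v v0 Jv] := projective_nullstellensatz hJ; last by exists v.
    apply: nJ; exists 0, s => m mm; apply: adj_sub.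
    exact: (mpow_leq iJ ms (leqnSn s)).
  - move=> Z1 Z2 clZ1 clZ2 WZ; apply: boolp.contrapT => /boolp.not_orP [n1 n2].
    have W0 : psubset W (@pspace k n) by move=> v [].
    have [d1 [f1 [h1 Zf1 nf1]]] := closed_in_separate clZ1 W0 n1.
    have [d2 [f2 [h2 Zf2 nf2]]] := closed_in_separate clZ2 W0 n2.
    have /WJ1 J12 : vanish W (f1 * f2).
      apply/(vanish_homogP W (dhomogM h1 h2)) => v /WZ [Zv|Zv]; rewrite mevalM.
        by rewrite (vanish_eval Zf1 Zv) mul0r.
      by rewrite (vanish_eval Zf2 Zv) mulr0.
    by have [/J1W|/J1W] := max_uncut_prime mJ h1 h2 J12.
have [C [C0 irC CC]] : exists C : nat -> pset k n, 
      [/\ psame (C 0%N) W,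
          forall i, (i <= c)%N -> irreducible_in (@pspace k n) (C i) &
          forall i, (i < c)%N ->
            psubset (C i) (C i.+1) /\ ~ psubset (C i.+1) (C i)].
  by apply: chains => // v p [_ H] /J01; apply: H.
(* Descending induction along the chain, written as an induction on [c - i]. *)
have cutC i : (i <= c)%N -> cut_empty (r + i) (vanish (C i)).
  move=> ic; rewrite -(subKn ic); move: (c - i)%N (leq_subr i c) => {ic}i.
  elim: i => [|i IH] ic; first by rewrite subn0 rc; apply/cut_empty_all/ideal_vanish.
  have ci : (c - i = (c - i.+1).+1)%N by lia.
  have [C1 C2] : psubset (C (c - i.+1)%N) (C (c - i)%N) /\
      ~ psubset (C (c - i)%N) (C (c - i.+1)%N) by rewrite ci; apply: CC; lia.
  apply: cut_empty_drop C1 C2 _; first by apply: irC; lia.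
    by case: (irC (c - i.+1)%N) => //; lia.
  by rewrite -addnS -ci; apply: IH; lia.
apply: nW; have := cutC 0%N isT; rewrite addn0; apply: cut_empty_mono => p.
by apply: vanish_sub => v /C0.
Qed.

End CodimensionToForms.

(** * Powers of distinct variables form a regular sequence *)

Section MonomialIdeals.

Variables (n : nat) (R : comNzRingType).
Implicit Types u w : {mpoly R[n]}.

Lemma mcoeff_mulXn_lt (i : 'I_n) s u (m : 'X_{1..n}) : (m i < s)%N ->
  ('X_i ^+ s * u)@_m = 0.
Proof.
move=> lt; rewrite mpolyXn mulrC; apply: memN_msupp_eq0.
rewrite (perm_mem (msuppMX _ _)); apply/mapP => -[m' _ E].
by move: lt; rewrite E mnmDE mulmnE mnm1E eqxx mul1n ltnNge leq_addr.
Qed.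

Lemma mulXn_pair_split (i j : 'I_n) s u :
  exists u1 u2 u0, [/\ u = 'X_i ^+ s * u1 + 'X_j ^+ s * u2 + u0 &
    forall m : 'X_{1..n}, (s <= m i)%N || (s <= m j)%N -> u0@_m = 0].
Proof.
elim/mpolyind: u => [|c m p _ _ [p1 [p2 [p0 [pE p0P]]]]].
  by exists 0, 0, 0; rewrite !mulr0 !addr0; split=> // m _; rewrite mcoeff0.
have XE l : (s <= m l)%N ->
    'X_[m] = 'X_l ^+ s * 'X_[m - U_(l) *+ s] :> {mpoly R[n]}.
  move=> sm; rewrite mpolyXn -mpolyXD addmC submK //; apply/mnm_lepP => a.
  by rewrite mulmnE mnm1E; case: eqP => [<-|]; rewrite ?mul1n.
have [si|si] := leqP s (m i).
  exists (c *: 'X_[m - U_(i) *+ s] + p1), p2, p0; split=> //.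
  by rewrite mulrDr -scalerAr -XE // pE !addrA.
have [sj|sj] := leqP s (m j).
  exists p1, (c *: 'X_[m - U_(j) *+ s] + p2), p0; split=> //.
  by rewrite mulrDr -scalerAr -XE // pE; ring.
exists p1, p2, (c *: 'X_[m] + p0); split=> [|m' m's]; first by rewrite pE; ring.
rewrite mcoeffD mcoeffZ mcoeffX p0P // addr0; case: eqP => [E|]; last by rewrite mulr0.
by move: m's; rewrite -E => /orP []; rewrite leqNgt ?si ?sj.
Qed.

(** Modulo the two powers, [u] reduces to a [u0] whose exponents in [i] and [j] are below [s].
    Multiplication by a power of another variable keeps these exponents, and no such monomial occurs
    in the ideal of the two powers. *)
Lemma mulXn_regular_pair (i j l : 'I_n) s u w w' : l != i -> l != j ->
  'X_l ^+ s * u = 'X_i ^+ s * w + 'X_j ^+ s * w' ->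
  exists u1 u2, u = 'X_i ^+ s * u1 + 'X_j ^+ s * u2.
Proof.
move=> li lj E; have [u1 [u2 [u0 [uE u0P]]]] := mulXn_pair_split i j s u.
exists u1, u2; rewrite uE; suff -> : u0 = 0 by rewrite addr0.
apply/mpolyP => m; rewrite mcoeff0.
have [si|si] := leqP s (m i); first by apply: u0P; rewrite si.
have [sj|sj] := leqP s (m j); first by apply: u0P; rewrite sj orbT.
have E0 : 'X_l ^+ s * u0 =
    'X_i ^+ s * (w - 'X_l ^+ s * u1) + 'X_j ^+ s * (w' - 'X_l ^+ s * u2).
  have -> : u0 = u - 'X_i ^+ s * u1 - 'X_j ^+ s * u2 by rewrite uE; ring.
  by rewrite !mulrBr E; ring.
have := congr1 (mcoeff (U_(l) *+ s + m)) E0.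
have low a : l != a -> (m a < s)%N -> ((U_(l) *+ s + m)%MM a < s)%N.
  by move=> la ma; rewrite mnmDE mulmnE mnm1E (negbTE la).
rewrite mcoeffD [X in _ = X + _]mcoeff_mulXn_lt ?low //.
rewrite [X in _ = _ + X]mcoeff_mulXn_lt ?low // addr0.
by rewrite mpolyXn mulrC mcoeffMX.
Qed.

Lemma mulXn_regular (i l : 'I_n) s u w : l != i ->
  'X_l ^+ s * u = 'X_i ^+ s * w -> exists u1, u = 'X_i ^+ s * u1.
Proof.
(* The pair case with both indices equal to [i]. *)
move=> li E; have [|u1 [u2 ->]] := @mulXn_regular_pair i i l s u w 0 li li.
  by rewrite E mulr0 addr0.
by exists (u1 + u2); rewrite mulrDr.
Qed.

Lemma mulXn_inj (i : 'I_n) s : injective (fun u => 'X_i ^+ s * u).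
Proof.
move=> u w E; apply/mpolyP => m; have := congr1 (mcoeff (U_(i) *+ s + m)) E.
by rewrite /= mpolyXn ![_ * u]mulrC ![_ * w]mulrC !mcoeffMX.
Qed.

End MonomialIdeals.

(** * Exactness of the Koszul complex in degree 2 *)

Section Koszul.

Variables (k : fieldType) (N m : nat) (x y z : 'I_m) (s d : nat).
Local Notation S := {mpoly k[m]}.
Variables (A : 'I_N -> S) (T : 'I_N -> 'I_N -> S) (B1 B2 B3 : 'I_N -> S).
Hypotheses (yx : y != x) (zx : z != x) (zy : z != y).
Hypothesis A_homog : forall i, A i \is d.+1.-homog.
Hypothesis T_homog : forall i j, T i j \is d.-homog.
Hypothesis AT : forall i j l, wedge12 A T i j l = 0.
Hypothesis B1E : 'X_x ^+ s = \sum_i B1 i * A i.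
Hypothesis B2E : 'X_y ^+ s = \sum_i B2 i * A i.
Hypothesis B3E : 'X_z ^+ s = \sum_i B3 i * A i.

(* The regular sequence x^s, y^s, z^s in the ideal of the A i makes the Koszul
   complex of A exact in degree 2: T = A /\ xi, which is absurd for degree
   reasons unless T = 0. *)
Lemma wedge12_eq0 i j : T i j = 0.
Proof.
(* Contracting A /\ T = 0 with [B1] gives x^s T = A /\ eta; contracting this with [B2] gives y^s eta
   = sigma A + x^s tau. *)
pose eta l := \sum_i B1 i * T i l.
have T1 a b : 'X_x ^+ s * T a b = A a * eta b - A b * eta a.
  rewrite B1E mulr_suml /eta !mulr_sumr -sumrB; apply: eq_bigr => c _.
  have /eqP := AT c a b; rewrite /wedge12 addrAC subr_eq0 => /eqP E.
  rewrite -mulrA (_ : A c * T a b = A a * T c b - A b * T c a); first by ring.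
  by rewrite -E; ring.
pose sigma := \sum_a B2 a * eta a; pose tau b := \sum_a B2 a * T a b.
have T2 b : 'X_y ^+ s * eta b = A b * sigma + 'X_x ^+ s * tau b.
  rewrite B2E /sigma /tau mulr_suml !mulr_sumr -big_split; apply: eq_bigr => a _.
  by rewrite /= [_ ^+ _ * _]mulrCA T1; ring.
clearbody sigma tau eta.
(* Contracting the formula for y^s eta with [B3] shows that z^s sigma lies in (x^s, y^s). *)
have [u1 [u2 sE]] : exists u1 u2, sigma = 'X_x ^+ s * u1 + 'X_y ^+ s * u2.
  apply: (@mulXn_regular_pair _ _ x y z s _
    (- \sum_b B3 b * tau b) (\sum_b B3 b * eta b)) => //.
  rewrite B3E mulrN !mulr_sumr mulr_suml -sumrN -big_split.
  apply: eq_bigr => b _ /=; rewrite [in RHS]mulrCA [X in _ + X]mulrCA T2; ring.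
(* Now y^s (eta - u2 A) is divisible by x^s, hence so is eta - u2 A; the term u2 A disappears in A
   /\ eta. *)
have /fin_all_exists [xi xiE] b : exists xi, eta b = A b * u2 + 'X_x ^+ s * xi.
  have [|xi E] := @mulXn_regular _ _ x y s (eta b - A b * u2) (A b * u1 + tau b) yx.
    by rewrite mulrBr T2 sE; ring.
  by exists xi; rewrite -E addrC subrK.
have TE a b : T a b = A a * xi b - A b * xi a.
  apply: (@mulXn_inj _ _ x s); rewrite /= T1 !xiE; ring.
rewrite -[T i j](pihomog_dE (T_homog i j)) TE pihomogB.
by rewrite !(pihomogMl_lt _ (A_homog _)) ?subrr.
Qed.

End Koszul.

(** * Reduction to three variables by restriction to a plane *)

Section PlaneRestriction.

Variables (k : closedFieldType) (n r d : nat).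
Hypothesis rn : (r + 3)%N = n.+1.
Local Notation S := {mpoly k[n.+1]}.
Local Notation S3 := {mpoly k[3]}.

Lemma mmap_comp (R R1 R2 : comNzRingType) m (f : {rmorphism R -> R1})
    (g : {rmorphism R1 -> R2}) (h : 'I_m -> R1) (p : {mpoly R[m]}) :
  g (mmap f h p) = mmap (g \o f) (g \o h) p.
Proof.
rewrite /mmap rmorph_sum; apply: eq_bigr => m' _; rewrite rmorphM rmorph_prod /=.
by congr (_ * _); apply: eq_bigr => i _; rewrite rmorphXn.
Qed.

(** [P] parametrizes a projective plane on which the forms vanish, and [Q] provides linear forms
    that restrict to its three coordinates. *)
Lemma plane_in_forms (L : 'M[k]_(r, n.+1)) :
  exists (P : 'M_(3, n.+1)) (Q : 'M_(n.+1, 3)), P *m L^T = 0 /\ P *m Q = 1%:M.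
Proof.
have rk : (3 <= \rank (kermx L^T))%N.
  by rewrite mxrank_ker mxrank_tr; have := rank_leq_row L; lia.
pose M := row_base (kermx L^T).
have [M' MM'] : exists M', M *m M' = 1%:M by apply/row_freeP/row_base_free.
exists (pid_mx 3 *m M), (M' *m pid_mx 3); split.
  rewrite -mulmxA; suff -> : M *m L^T = 0 by rewrite mulmx0.
  by apply/sub_kermxP; rewrite eq_row_base.
rewrite mulmxA -[_ *m M *m _]mulmxA MM' mulmx1 pid_mx_id //.
by apply/matrixP => i j; rewrite !mxE ltn_ord andbT.
Qed.

Lemma homog_coef_mmap (h : 'I_n.+1 -> {poly S3}) e (p : S) :
  (forall i a, (h i)`_a \is 1.-homog) -> p \is e.-homog ->
  forall a, (mmap (polyC \o @mpolyC 3 k) h p)`_a \is e.-homog.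
Proof.
move=> hh /dhomogP hp a; rewrite /mmap coef_sum big_seq; apply: rpred_sum => m mp.
rewrite /= coefCM mul_mpolyC; apply: rpredZ; have /= <- := hp _ mp.
have homM e1 e2 (q1 q2 : {poly S3}) : (forall b, q1`_b \is e1.-homog) ->
    (forall b, q2`_b \is e2.-homog) -> forall b, (q1 * q2)`_b \is (e1 + e2).-homog.
  by move=> h1 h2 b; rewrite coefM; apply: rpred_sum => c _; apply: dhomogM.
have hom1 b : (1 : {poly S3})`_b \is 0.-homog.
  by rewrite coef1; case: eqP => _; rewrite ?dhomog1 ?dhomog0.
rewrite /mmap1 mdegE; elim/big_rec2: _ a => [//|i e' q _ IH].
apply: (homM _ _ _ _ _ IH).
by elim: (m i) => [//|c IHc] b; rewrite exprS; apply: (homM 1%N c).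
Qed.

(** A nonzero [T] may vanish on the chosen plane, so the plane is deformed with a parameter X until
    [T] is seen. The lowest coefficient of [T] in X still satisfies the wedge relation with the
    restriction of [A] to the plane, and the three-variable case kills it. *)
Theorem wedge12_eq0_of_cut_empty (A : 'I_n.+1 -> S) (T : 'I_n.+1 -> 'I_n.+1 -> S) :
  (forall i, A i \is d.+1.-homog) -> (forall i j, T i j \is d.-homog) ->
  (forall i j l, wedge12 A T i j l = 0) ->
  cut_empty r (adj (fun p => p = 0) A) -> forall i j, T i j = 0.
Proof.
move=> hA hT AT [L [s ms]] i0 j0; apply/eqP; apply: contraT.
move=> /mpoly_nonzero_point [v Tv].
have [P [Q [PL PQ]]] := plane_in_forms L.
pose rho i : S3 := \sum_j P j i *: 'X_j.
(* At X = 0 this is the plane [P]; at X = 1 the point (1, 0, 0) is sent to [v]. *)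
pose h i : {poly S3} := (rho i)%:P + ((v i - P ord0 i) *: 'X_ord0) *: 'X.
pose Phi (p : S) : {poly S3} := mmap (polyC \o @mpolyC 3 k) h p.
have rho_homog i : rho i \is 1.-homog.
  by apply: rpred_sum => j _; apply: rpredZ; rewrite dhomogX /= mdeg1.
have h_homog i a : (h i)`_a \is 1.-homog.
  rewrite coefD coefC coefZ coefX; apply: rpredD.
    by case: eqP => _; rewrite ?rho_homog ?dhomog0.
  case: eqP => _; rewrite ?mulr0 ?dhomog0 // mulr1.
  by apply: rpredZ; rewrite dhomogX /= mdeg1.
have Phi0 p : (Phi p)`_0 = mmap (@mpolyC 3 k) rho p.
  rewrite -horner_coef0 -horner_evalE /Phi mmap_comp /mmap; apply: eq_bigr => m _.
  rewrite /= /horner_eval hornerC; congr (_ * _); apply: eq_bigr => i _.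
  by rewrite /= /h hornerD hornerC hornerZ hornerX mulr0 addr0.
have PhiT : Phi (T i0 j0) != 0.
  apply: contraNneq Tv => E.
  have := congr1 (fun q : {poly S3} => q.[1].@[fun j => (j == ord0)%:R]) E.
  rewrite horner0 meval0 => E0; apply/eqP; rewrite -[RHS]E0 -horner_evalE /Phi.
  rewrite (mmap_comp _ (horner_eval 1)) (mmap_comp _ (meval _)) [LHS]/meval /mmap.
  apply: eq_bigr => m _; rewrite /= /horner_eval hornerC; congr (_ * _).
    by rewrite mevalC.
  apply: eq_bigr => i _; rewrite /= /h hornerD hornerC hornerZ.
  rewrite hornerX mulr1 mevalD mevalZ mevalXU eqxx mulr1 /rho raddf_sum /=.
  rewrite (bigD1 ord0) //= mevalZ mevalXU eqxx mulr1 big1 ?addr0 ?subrKC // => b.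
  by move=> /negbTE b0; rewrite mevalZ mevalXU b0 mulr0.
have PhiZ : Phi 0 = 0 by rewrite /Phi rmorph0.
have PhiW i j l : Phi (A i) * Phi (T j l) - Phi (A j) * Phi (T i l) +
    Phi (A l) * Phi (T i j) = Phi (wedge12 A T i j l).
  by rewrite /Phi /wedge12 rmorphD rmorphB !rmorphM.
have Phi_homog e p b : p \is e.-homog -> (Phi p)`_b \is e.-homog.
  by move=> hp; apply: homog_coef_mmap.
clearbody Phi.
(* [a] is the least order in X among all the [Phi (T i j)]. *)
have [a Ta mina] : exists2 a, (exists i j, (Phi (T i j))`_a != 0) &
    forall i j b, (b < a)%N -> (Phi (T i j))`_b = 0.
  have ex : exists a, [exists i, [exists j, (Phi (T i j))`_a != 0]].
    exists (size (Phi (T i0 j0))).-1; apply/existsP; exists i0; apply/existsP.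
    by exists j0; rewrite -lead_coefE lead_coef_eq0.
  case: (ex_minnP ex) => a /existsP [i /existsP [j Ta]] mina; exists a.
    by exists i, j.
  move=> i' j' b ba; apply/eqP; apply: contraLR ba => Tb; rewrite -leqNgt.
  by apply: mina; apply/existsP; exists i'; apply/existsP; exists j'.
have low p i j : (Phi p * Phi (T i j))`_a = (Phi p)`_0 * (Phi (T i j))`_a.
  rewrite coefM big_ord_recl subn0 big1 ?addr0 // => b _.
  rewrite [X in _ * X](mina i j) ?mulr0 //.
  by rewrite ltn_subrL andTb (leq_ltn_trans (leq0n b) (ltn_ord b)).
have rhoL i : mmap (@mpolyC 3 k) rho (lform L i) = 0.
  rewrite /lform rmorph_sum /=; under eq_bigr do rewrite mmapZ mmapX mmap1U mulr_sumr.
  rewrite exchange_big big1 //= => b _.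
  under eq_bigr do rewrite -mul_mpolyC mulrA -mpolyCM.
  rewrite -mulr_suml -raddf_sum /= (_ : \sum_i _ = (P *m L^T) b i).
    by rewrite PL mxE mpolyC0 mul0r.
  by rewrite mxE; apply: eq_bigr => c _; rewrite mxE mulrC.
(* The form [q] restricts to the coordinate [b] of the plane, and its power lies in (A) + (L), where
   [L] restricts to 0. *)
have powers b : exists g : 'I_n.+1 -> S3,
    'X_b ^+ s.+1 = \sum_i g i * (Phi (A i))`_0.
  pose q : S := \sum_i Q i b *: 'X_i.
  have hq : q \is 1.-homog.
    by apply: rpred_sum => i _; apply: rpredZ; rewrite dhomogX /= mdeg1.
  have iZ : ideal (fun p : S => p = 0).
    by split=> [//|p p' -> ->|p p' ->]; rewrite ?addr0 ?mulr0.
  have iJ : ideal (adj (adj (fun p => p = 0) A) (lform L)).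
    exact: ideal_adj (ideal_adj A iZ).
  have hqs : q ^+ s.+1 \is s.+1.-homog.
    by have := dhomogMn s.+1 hq; rewrite mul1n.
  have [gl [ga /eqP]] := mpow_homog iJ ms hqs.
  rewrite subr_eq0 subr_eq => /eqP E.
  exists (fun i => mmap (@mpolyC 3 k) rho (ga i)).
  have <- : mmap (@mpolyC 3 k) rho q = 'X_b.
    rewrite /q rmorph_sum /=; under eq_bigr do rewrite mmapZ mmapX mmap1U mulr_sumr.
    rewrite exchange_big /=.
    under eq_bigr => c _.
      under eq_bigr do rewrite -mul_mpolyC mulrA -mpolyCM.
      rewrite -mulr_suml -raddf_sum /= (_ : \sum_i _ = (P *m Q) c b); last first.
        by rewrite mxE; apply: eq_bigr => e _; rewrite mulrC.
      rewrite PQ mxE; over.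
    rewrite (bigD1 b) //= eqxx mul1r big1 ?addr0 // => c /negbTE ->.
    by rewrite mpolyC0 mul0r.
  rewrite -rmorphXn /= E rmorphD !rmorph_sum /= [X in _ + X]big1 ?addr0.
    by apply: eq_bigr => i _; rewrite rmorphM /= Phi0.
  by move=> i _; rewrite rmorphM /= rhoL mulr0.
have [B1 E1] := powers ord0; have [B2 E2] := powers (@Ordinal 3 1 isT).
have [B3 E3] := powers ord_max.
case: Ta => i [j /eqP Ta]; case: Ta.
apply: (@wedge12_eq0 _ _ _ ord0 (@Ordinal 3 1 isT) ord_max s.+1 d
  (fun i => (Phi (A i))`_0) (fun i j => (Phi (T i j))`_a) B1 B2 B3) => //.
- by move=> i1; apply: Phi_homog.
- by move=> i1 j1; apply: Phi_homog.
move=> i1 j1 l1.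
rewrite /wedge12 -(low (A i1) j1 l1) -(low (A j1) i1 l1) -(low (A l1) i1 j1).
by rewrite -coefB -coefD PhiW AT PhiZ coef0.
Qed.

End PlaneRestriction.

(** * Codimension in an open subset *)

Section OpenSubsets.

Variables (k : closedFieldType) (n : nat).
Implicit Types (U Z W C : pset k n).

Lemma popen_pspace U : popen U -> psubset U (@pspace k n).
Proof. by case=> Z [_ UE] v /UE []. Qed.

Definition pclosure W : pset k n :=
  fun v => v != 0 /\ forall d p, p \is d.-homog -> vanish W p -> p.@[v 0] = 0.

Lemma pclosed_pclosure W : pclosed (pclosure W).
Proof.
exists (fun p => (exists d, p \is d.-homog) /\ vanish W p); split=> [p []//|v].
split=> -[v0 H]; split=> //; first by move=> p [[d hp]]; apply: H hp.
by move=> d p hp Wp; apply: H; split=> //; exists d.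
Qed.

Lemma sub_pclosure W : psubset W (@pspace k n) -> psubset W (pclosure W).
Proof.
by move=> W0 v Wv; split=> [|d p _ Wp]; [apply: W0 | apply: vanish_eval Wv].
Qed.

Lemma pclosure_min W Z : closed_in (@pspace k n) Z -> psubset W Z ->
  psubset (pclosure W) Z.
Proof.
move=> clZ WZ; apply: boolp.contrapT => nZ.
have [v []//|d [f [hf Zf []]]] := closed_in_separate clZ _ nZ.
apply/(vanish_homogP _ hf) => v [_ /(_ d f hf)]; apply; exact: vanish_sub Zf.
Qed.

Lemma closed_in_pspace Z : pclosed Z -> closed_in (@pspace k n) Z.
Proof.
move=> clZ; exists Z; split=> // v; split=> [Zv|[]//]; split=> //.
by case: clZ => F [_ ZE]; case/ZE: Zv.
Qed.

(** A point outside both sets is separated from each by a form, and the product of the two forms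
    separates it from the union. *)
Lemma closed_inU Z1 Z2 :
  closed_in (@pspace k n) Z1 -> closed_in (@pspace k n) Z2 ->
  closed_in (@pspace k n) (fun v => Z1 v \/ Z2 v).
Proof.
move=> cl1 cl2.
have Z0 Z : closed_in (@pspace k n) Z -> psubset Z (@pspace k n).
  by move=> [C [_ ZE]] v /ZE [].
have U0 : psubset (fun v => Z1 v \/ Z2 v) (@pspace k n).
  by move=> v [] /Z0; apply.
have [C [clC CE]] := closed_in_pspace (pclosed_pclosure (fun v => Z1 v \/ Z2 v)).
exists C; split=> // v; split=> [/(sub_pclosure U0)/CE//|/CE Uv].
apply: boolp.contrapT => /boolp.not_orP [n1 n2].
have sep Z : closed_in (@pspace k n) Z -> ~ Z v ->
    exists d f, [/\ f \is d.-homog, vanish Z f & f.@[v 0] != 0].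
  move=> clZ nZv; have [w <-||d [f [hf Zf nf]]] := @closed_in_separate _ _ (eq v) Z clZ.
  - by case: Uv.
  - by move/(_ v erefl).
  - exists d, f; split=> //; apply/eqP => fv; apply: nf.
    by apply/(vanish_homogP _ hf) => w <-.
have [d1 [f1 [h1 Zf1 /negbTE fv1]]] := sep _ cl1 n1.
have [d2 [f2 [h2 Zf2 /negbTE fv2]]] := sep _ cl2 n2.
have [_ /(_ _ _ (dhomogM h1 h2))] := Uv.
rewrite mevalM => /(_ _)/eqP; rewrite mulf_eq0 fv1 fv2 => H; apply/notF/H.
apply/(vanish_homogP _ (dhomogM h1 h2)) => w [Zw|Zw]; rewrite mevalM.
  by rewrite (vanish_eval Zf1 Zw) mul0r.
by rewrite (vanish_eval Zf2 Zw) mulr0.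
Qed.

Lemma irreducible_pclosure U W : psubset U (@pspace k n) ->
  irreducible_in U W -> irreducible_in (@pspace k n) (pclosure W).
Proof.
move=> U0 [[C [clC WE]] [w Ww] irW].
have WU : psubset W U by move=> v /WE [].
have W0 : psubset W (@pspace k n) by move=> v /WU/U0.
split; first exact/closed_in_pspace/pclosed_pclosure.
  by exists w; apply: sub_pclosure.
move=> Z1 Z2 cl1 cl2 WZ.
have clU Z : closed_in (@pspace k n) Z -> closed_in U (fun v => U v /\ Z v).
  move=> [Z' [clZ' ZE]]; exists Z'; split=> // v; split=> [[Uv /ZE []]//|[Uv Z'v]].
  by split=> //; apply/ZE; split=> //; apply: U0.
have [v Wv|H|H] := irW _ _ (clU _ cl1) (clU _ cl2).
- have Uv := WU _ Wv; have [Zv|Zv] := WZ _ (sub_pclosure W0 Wv).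
    by left; split.
  by right; split.
- by left; apply: pclosure_min => // v /H [].
- by right; apply: pclosure_min => // v /H [].
Qed.

Lemma irreducible_open U C : popen U -> irreducible_in (@pspace k n) C ->
  (exists v, U v /\ C v) -> irreducible_in U (fun v => U v /\ C v).
Proof.
move=> [Z [clZ UE]] [[C' [clC' CE]] _ irC] [v0 [Uv0 Cv0]]; split.
- by exists C'; split=> // v; split=> [[Uv /CE []]//|[Uv C'v]]; split=> //;
    apply/CE; split=> //; case/UE: Uv.
- by exists v0.
move=> Z1 Z2 [Z1' [cl1 E1]] [Z2' [cl2 E2]] UC.
have cl12 := closed_inU (closed_in_pspace cl1) (closed_in_pspace cl2).
have C0 v : C v -> v != 0 by move/CE => [].
have [v Cv|H|H] := irC _ _ (closed_in_pspace clZ) cl12.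
- have [Zv|nZv] := boolp.pselect (Z v); first by left.
  have Uv : U v by apply/UE; split=> //; apply: C0.
  by right; have [/E1 []|/E2 []] := UC v (conj Uv Cv); [left|right].
- by case/UE: Uv0 => _ []; apply: H.
have [v /H //|H1|H2] := irC _ _ (closed_in_pspace cl1) (closed_in_pspace cl2).
- by left=> v [Uv /H1 Z1v]; apply/E1.
- by right=> v [Uv /H2 Z2v]; apply/E2.
Qed.

(** The closure of an irreducible closed subset of [U] is irreducible in projective space; a chain
    above this closure is intersected with [U]. *)
Lemma codim_ge_open U Z Z' c : popen U -> pclosed Z ->
  psubset Z' (fun v => U v /\ Z v) ->
  codim_ge (@pspace k n) Z c -> codim_ge U Z' c.
Proof.
move=> opU clZ Z'Z codZ W irW WZ'; have U0 := popen_pspace opU.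
have [[C0 [clC0 WE]] [w Ww] _] := irW.
have WU : psubset W U by move=> v /WE [].
have W0 : psubset W (@pspace k n) by move=> v /WU/U0.
have WZ : psubset (pclosure W) Z.
  by apply: pclosure_min; [apply: closed_in_pspace | move=> v /WZ'/Z'Z []].
have [C [CW irC CC]] := codZ _ (irreducible_pclosure U0 irW) WZ.
have Cw i : (i <= c)%N -> C i w.
  elim: i => [|i IH] ic; first by apply/CW/sub_pclosure.
  by have [+ _] := CC i ic; apply; apply: IH; apply: ltnW.
exists (fun i v => U v /\ C i v); split=> [v|i ic|i ic].
- split=> [[Uv /CW Wv]|Wv]; last by split; [apply: WU | apply/CW/sub_pclosure].
  apply/WE; split=> //; apply: (pclosure_min (closed_in_pspace clC0) _ Wv).
  by move=> u /WE [].
- apply: irreducible_open => //; first exact: irC.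
  by exists w; split; [apply: WU | apply: Cw].
have [C1 C2] := CC i ic; split=> [v [Uv /C1]//|H]; apply: C2.
have [Z0 [clZ0 UE]] := opU.
have [clCi _ _] := irC i (ltnW ic); have [[C' [_ CE]] _ irC1] := irC _ ic.
(* Strictness: the larger member is irreducible and meets [U] at [w], so if its part in [U] lay in
   the smaller member, all of it would. *)
have [v Cv|H1|//] := irC1 _ _ (closed_in_pspace clZ0) clCi.
  have [Zv|nZv] := boolp.pselect (Z0 v); first by left.
  right; have [|//] := H v; split=> //; apply/UE; split=> //.
  by case/CE: Cv.
by have /UE [_ []] := WU _ Ww; apply/H1/Cw.
Qed.

End OpenSubsets.

(** * Invariance as divisibility of Omega /\ dF by F *)

Section InvarianceDivides.

Variables (k : closedFieldType) (n : nat).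
Hypothesis n_gt0 : (0 < n)%N.
Local Notation S := {mpoly k[n.+1]}.
Implicit Types (p q F G : S).

Lemma mderiv_homog m d (p : {mpoly k[m]}) i :
  p \is d.+1.-homog -> p^`M(i) \is d.-homog.
Proof.
move=> /dhomogP hp; apply/dhomogP => m'; rewrite mcoeff_msupp mcoeff_mderiv => nz.
have /hp : (m' + U_(i))%MM \in msupp p.
  by rewrite mcoeff_msupp; apply: contraNneq nz => ->; rewrite mul0rn.
by rewrite /= mdegD mdeg1 addn1 => -[].
Qed.

(** The ideal of local denominators contains x_0^s and x_n^s for some s. From x_0^s G = F H0 and
    x_n^s G = F H1 follows x_n^s H0 = x_0^s H1, so x_0^s divides H0. *)
Lemma dvd_of_local_dvd F G e e' :
  F != 0 -> F \is e.-homog -> G \is (e + e').-homog ->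
  (forall v : 'rV[k]_n.+1, v != 0 ->
     exists q, q.@[v 0] != 0 /\ exists H, q * G = F * H) ->
  exists H, G = F * H.
Proof.
move=> F0 hF hG local; pose J q := exists H, q * G = F * H.
have iJ : ideal J.
  split; first by exists 0; rewrite mul0r mulr0.
    by move=> p q [H1 E1] [H2 E2]; exists (H1 + H2); rewrite mulrDl E1 E2 mulrDr.
  by move=> p q [H E]; exists (p * H); rewrite -mulrA E mulrCA.
have hJ : hideal J.
  split=> // d p [H E]; exists (pihomog mdeg (e' + d) H).
  by rewrite mulrC -(pihomogMl _ _ hG) -(pihomogMl _ _ hF) addnA mulrC E.
have [s ms] : exists s, mpow s J.
  apply: boolp.contrapT => /boolp.forallNP.
  move=> /(projective_nullstellensatz hJ) [v v0 Jv].
  by have [q [/eqP qv Jq]] := local v v0; apply/qv/Jv.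
have powJ i : J ('X_i ^+ s).
  by rewrite mpolyXn; apply: ms; rewrite mdegMn mdeg1 mul1n.
have [[H0 E0] [H1 E1]] := (powJ ord0, powJ ord_max).
have [||H E] := @mulXn_regular _ _ ord0 ord_max s H0 H1.
- by rewrite -val_eqE /= -lt0n.
- by apply: (mulfI F0); rewrite mulrCA -E0 [RHS]mulrCA -E1; ring.
by exists H; apply: (@mulXn_inj _ _ ord0 s); rewrite /= E0 E; ring.
Qed.

(** Clears denominators in a coefficient of omega /\ df/f, where omega is Omega / y, the local
    equation is the quotient of [f] by [x], and its derivatives follow the quotient rule. *)
Lemma wedge11_frac_identity (K : fieldType) (a a' f f1 f2 p q x x1 x2 y : K) :
  f != 0 -> q != 0 -> x != 0 -> y != 0 ->
  a / y * ((f2 * x - f * x2) / x ^+ 2 / (f / x)) -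
    a' / y * ((f1 * x - f * x1) / x ^+ 2 / (f / x)) = p / q ->
  q * (a * (f2 * x - f * x2) - a' * (f1 * x - f * x1)) = p * y * f * x.
Proof.
move=> f0 q0 x0 y0 E; have -> : p = (p / q) * q by rewrite mulfVK.
by rewrite -E; field; rewrite f0 x0 y0.
Qed.

Variables (D : distribution k n) (Y : reduced_hypersurface k n).
Local Notation A := (dist_coef D).
Local Notation d := (dist_deg D).
Local Notation F := (hyp_eq Y).
Local Notation m := (hyp_deg Y).

Let frac0 p : p != 0 -> frac_of p != 0. Proof. by rewrite tofrac_eq0. Qed.

Let frac1 : frac_of 1 = 1 :> {fraction S}. Proof. exact: tofrac1. Qed.

Let XU_neq0 (l : 'I_n.+1) : 'X_l != 0 :> S.
Proof. by rewrite -msize_poly_eq0 msizeX. Qed.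

Let homXn (l : 'I_n.+1) e : ('X_l ^+ e : S) \is e.-homog.
Proof.
have h1 : ('X_l : S) \is 1.-homog by rewrite dhomogX /= mdeg1.
by have := dhomogMn e h1; rewrite mul1n.
Qed.

Let evXn (l : 'I_n.+1) e (v : 'rV[k]_n.+1) : v 0 l != 0 ->
  ('X_l ^+ e : S).@[v 0] != 0.
Proof. by move=> vl; rewrite rmorphXn /= mevalXU expf_neq0. Qed.

Definition chart (l : 'I_n.+1) : pset k n := fun v => v != 0 /\ v 0 l != 0.

Lemma popen_chart l : popen (chart l).
Proof.
exists (pzeros 'X_l); split.
  have [C [clC CE]] : closed_in (@pspace k n) (pzeros ('X_l : S)).
    by apply: (@closed_zeros _ _ 1); rewrite dhomogX /= mdeg1.
  case: clC => T [hT TE]; exists T; split=> // v; split.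
    by move=> /CE [_ /TE].
  by move=> /TE Cv; apply/CE; split=> //; case/TE: Cv.
move=> v; rewrite /chart /pzeros mevalXU; split=> [[v0 /eqP vl]|[v0 vl]].
  by split=> // -[].
by split=> //; apply/eqP => E; apply: vl.
Qed.

Definition chart_eq l := frac_of F / frac_of ('X_l ^+ m).
(** The exponent d + 2 gives the coefficients degree -1, as required of a 1-form. *)
Definition chart_form l i := frac_of (A i) / frac_of ('X_l ^+ d.+2).

Lemma local_equation_chart l : local_equation Y (chart l) (chart_eq l).
Proof.
have nX e : frac_of ('X_l ^+ e : S) != 0 by rewrite frac0 // expf_neq0.
have nF := frac0 (hyp_neq0 Y).
split.
- rewrite /chart_eq; apply: mulf_neq0; first exact: nF.
  by rewrite invr_eq0; apply: nX.
- split=> [|v [_ vl]]; last by exists F, ('X_l ^+ m); split=> //; apply: evXn.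
  exists m, m, F, ('X_l ^+ m); split=> //; first exact: hyp_homog.
  + exact: expf_neq0.
  + by rewrite subrr.
- have E : frac_of F / chart_eq l = frac_of ('X_l ^+ m) / frac_of 1.
    by rewrite frac1 divr1 /chart_eq invf_div mulrCA divff ?mulr1 //; apply: nF.
  split=> [|v _]; rewrite E.
    by exists m, 0%N, ('X_l ^+ m), 1; split=> //; rewrite ?dhomog1 ?oner_neq0 ?subr0.
  by exists ('X_l ^+ m), 1; rewrite meval1 oner_neq0.
have E : chart_eq l / frac_of F = frac_of 1 / frac_of ('X_l ^+ m).
  by rewrite frac1 div1r /chart_eq mulrAC divff ?mul1r //; apply: nF.
split=> [|v [_ vl]]; rewrite E.
  exists 0%N, m, 1, ('X_l ^+ m); split=> //; rewrite ?dhomog1 ?expf_neq0 //.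
  by rewrite sub0r.
by exists 1, ('X_l ^+ m); split=> //; apply: evXn.
Qed.

Lemma local_form_chart l : local_form D (chart l) (chart_form l).
Proof.
have nX e : frac_of ('X_l ^+ e : S) != 0 by rewrite frac0 // expf_neq0.
split.
- split=> [i|].
    split=> [|v [_ vl]]; last by exists (A i), ('X_l ^+ d.+2); split=> //; apply: evXn.
    exists d.+1, d.+2, (A i), ('X_l ^+ d.+2); split=> //; first exact: dist_homog.
      exact: expf_neq0.
    lia.
  under eq_bigr do rewrite mulrA -tofracM.
  by rewrite -mulr_suml -raddf_sum /= dist_radial tofrac0 mul0r.
- by exists (frac_of ('X_l ^+ d.+2))^-1 => [|i]; rewrite ?invr_eq0 // mulrC.
have clA : pclosed (poly_zeros A).
  exists (fun p => exists i, p = A i); split=> [p [i ->]|v].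
    by exists d.+1; apply: dist_homog.
  split=> -[v0 H]; split=> //; first by move=> p [i ->]; apply: H.
  by move=> i; apply: H; exists i.
refine (codim_ge_open (popen_chart l) clA _ (@dist_codim _ _ D)).
move=> v [Uv H]; have [v0 vl] := Uv; split=> //; split=> // i.
have [p [q [qv /eqP E pv]]] := H i.
have q0 : q != 0 by apply: contraNneq qv => ->; rewrite meval0.
move: E; rewrite eqr_div ?frac0 ?expf_neq0 // -!tofracM tofrac_eq => /eqP.
move=> /(congr1 (meval (v 0))); rewrite !mevalM pv mul0r => /eqP.
by rewrite mulf_eq0 (negbTE qv) orbF => /eqP.
Qed.

Lemma invariant_dvd i j : is_invariant D Y ->
  exists H, wedge11 A (fun i => F^`M(i)) i j = F * H.
Proof.
move=> inv; have mE : m = m.-1.+1 by rewrite prednK // hyp_deg_gt0.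
have hF i' : F^`M(i') \is m.-1.-homog.
  by apply: mderiv_homog; rewrite -mE; apply: hyp_homog.
apply: (@dvd_of_local_dvd _ _ m d) (hyp_neq0 Y) (hyp_homog Y) _ _.
  have -> : (m + d = d.+1 + m.-1)%N by rewrite {1}mE; lia.
  by apply: rpredB; apply: dhomogM; rewrite ?hF ?dist_homog.
move=> v v0; have [l vl] : exists l, v 0 l != 0.
  apply/existsP; apply: contraT; rewrite negb_exists => /forallP H.
  by case/negP: v0; apply/eqP/rowP => l; rewrite mxE; apply/eqP/negPn/H.
have [_ _ sec _] :=
  inv _ _ _ (popen_chart l) (local_equation_chart l) (local_form_chart l).
have [_ /(_ v (conj v0 vl)) [p [q [qv E]]]] := sec i j.
have q0 : q != 0 by apply: contraNneq qv => ->; rewrite meval0.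
exists (q * 'X_l ^+ m); split; first by rewrite mevalM mulf_neq0 ?evXn.
have Q0 : 'X_l ^+ m != 0 :> S by apply: expf_neq0.
have P0 : 'X_l ^+ d.+2 != 0 :> S by apply: expf_neq0.
move: E; rewrite /wedge11 /chart_form /chart_eq.
move: ('X_l ^+ m) ('X_l ^+ d.+2) Q0 P0 => Q P Q0 P0 E.
(* With Q = x_l^m, the terms of the quotient rule containing derivatives of Q are multiples of F and
   move to the right-hand side. *)
exists (p * P * Q + q * wedge11 A (fun i => Q^`M(i)) i j).
have {}E : frac_of (q * (A i * (F^`M(j) * Q - F * Q^`M(j)) -
    A j * (F^`M(i) * Q - F * Q^`M(i)))) = frac_of (p * P * F * Q).
  move: E; rewrite !fderivE // /frac_of !(tofracB, tofracM, tofracXn).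
  apply: wedge11_frac_identity; apply: frac0 => //; exact: hyp_neq0.
move/eqP: E; rewrite /frac_of tofrac_eq => /eqP E; rewrite /wedge11.
transitivity (q * (A i * (F^`M(j) * Q - F * Q^`M(j)) -
  A j * (F^`M(i) * Q - F * Q^`M(i))) +
  F * (q * (A i * Q^`M(j) - A j * Q^`M(i)))); first by ring.
by rewrite E; ring.
Qed.

End InvarianceDivides.

(** * A reduced equation has a nonzero partial derivative *)

Lemma closed_field_root (k : closedFieldType) e (c : k) : (0 < e)%N ->
  exists b, b ^+ e = c.
Proof.
move=> e0; have : size ('X^e - c%:P) != 1%N.
  by rewrite size_XnsubC // eqSS -lt0n.
by move=> /closed_rootP [b]; rewrite rootE !hornerE subr_eq0 => /eqP; exists b.
Qed.

(** All exponents vanish in [k], hence are divisible by its characteristic p > 0. As [k] contains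
    p-th roots, F = G^p by additivity of Frobenius; G^2 divides F, so G would be a constant, against
    the positive degree of F. *)
Lemma mderiv_eq0_not_square_free (k : closedFieldType) n (F : {mpoly k[n.+1]}) d :
  F != 0 -> F \is d.+1.-homog -> (forall i, F^`M(i) = 0) -> ~ square_free F.
Proof.
move=> F0 /dhomogP hF dF sqF.
have exp0 m i : m \in msupp F -> (m i)%:R = 0 :> k.
  move=> mF; have [->|mi] := eqVneq (m i) 0%N => //.
  have := congr1 (mcoeff (m - U_(i))%MM) (dF i).
  rewrite mcoeff_mderiv submK ?lep1mP // mcoeff0 mnmBE mnm1E eqxx subn1.
  rewrite prednK ?lt0n //.
  rewrite -[F@_m *+ _]mulr_natr => /eqP; rewrite mulf_eq0 mcoeff_eq0 mF /=.
  by move/eqP.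
have [m0 m0F] : exists m, m \in msupp F.
  by exists (mlead F); apply: mlead_supp.
have [i0 mi0] : exists i, m0 i != 0%N.
  apply/existsP; apply: contraT; rewrite negb_exists => /forallP H.
  have := hF _ m0F; rewrite /= mdegE big1 // => i _; apply/eqP/negPn/H.
have [p pk] : exists p, p \in [pchar k].
  by apply: (@natf0_pchar _ (m0 i0)); rewrite ?lt0n // exp0.
have p_gt1 : (1 < p)%N by apply: prime_gt1; case/andP: pk.
have pdvd m i : m \in msupp F -> (p %| m i)%N.
  by move=> mF; rewrite (dvdn_pcharf pk) exp0.
have [b bE] := boolp.choice (fun c : k => closed_field_root c (ltnW p_gt1)).
pose G := \sum_(m <- msupp F) b F@_m *: 'X_[[multinom (m i %/ p)%N | i < n.+1]].
have GE : F = G ^+ p.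
  have pS : p \in [pchar {mpoly k[n.+1]}].
    exact: (rmorph_pchar (@mpolyC n.+1 k)).
  rewrite /G -(pFrobenius_autE pS) rmorph_sum /= {1}[F]mpolyE !big_seq.
  apply: eq_bigr => m mF; rewrite pFrobenius_autE exprZn bE mpolyXn.
  congr (_ *: 'X_[_]).
  by apply/mnmP => i; rewrite mulmnE mnmE divnK // pdvd.
have uG : G \is a GRing.unit.
  by apply: (sqF G (G ^+ (p - 2))); rewrite -exprD subnKC.
move: uG => /andP [/eqP Gc _]; move: m0F.
rewrite GE Gc -rmorphXn /= msuppC; case: ifP => // _.
by rewrite inE => /eqP E; rewrite E mnm0E in mi0.
Qed.

(** * A form proportional to dF is integrable *)

Section ClosedForm.

Variables (R : idomainType) (n : nat).
Variables (A : 'I_n -> {mpoly R[n]}) (F : {mpoly R[n]}).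
Hypothesis AF : forall i j, wedge11 A (fun i => F^`M(i)) i j = 0.

(** With g = dF/dx_j0 and a = A j0, proportionality reads g Omega = a dF. Differentiating, g dOmega
    = da /\ dF - dg /\ Omega, and its wedge with g Omega = a dF is 0. *)
Lemma wedge11_deriv_integrable j0 : F^`M(j0) != 0 ->
  forall i j l, wedge12 A (ext_d A) i j l = 0.
Proof.
move=> g0 i j l; set g := F^`M(j0) in g0; pose a := A j0.
have gA c : g * A c = a * F^`M(c).
  have /eqP := AF c j0; rewrite /wedge11 subr_eq0 => /eqP E.
  by rewrite mulrC E.
have gdA b c : g * (A c)^`M(b) =
    a^`M(b) * F^`M(c) + a * F^`M(b)^`M(c) - g^`M(b) * A c.
  have /(congr1 (mderiv b)) := gA c; rewrite !mderivM mderiv_comm => E.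
  by rewrite -[F^`M(b)^`M(c)]mderiv_comm in E *; rewrite -E; ring.
apply: (mulfI (expf_neq0 2 g0)); rewrite mulr0 /wedge12 /ext_d.
transitivity (g * A i * (g * (A l)^`M(j) - g * (A j)^`M(l)) -
  g * A j * (g * (A l)^`M(i) - g * (A i)^`M(l)) +
  g * A l * (g * (A j)^`M(i) - g * (A i)^`M(j))); first by ring.
rewrite !gdA [F^`M(l)^`M(j)]mderiv_comm [F^`M(l)^`M(i)]mderiv_comm.
rewrite [F^`M(j)^`M(i)]mderiv_comm.
transitivity (g * A i * (a^`M(j) * F^`M(l) - a^`M(l) * F^`M(j)) -
  g * A j * (a^`M(i) * F^`M(l) - a^`M(l) * F^`M(i)) +
  g * A l * (a^`M(i) * F^`M(j) - a^`M(j) * F^`M(i))); first by ring.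
by rewrite !gA; ring.
Qed.

End ClosedForm.

(** * Vanishing of the quotient form Theta and conclusion *)

Theorem theorem1p5 (k : closedFieldType) (n : nat) (hn : (2 <= n)%N)
    (D : distribution k n) (hD : ~ integrable D)
    (hS : codim_ge (@pspace k n) (Sing D) 3) :
  ~ exists Y : reduced_hypersurface k n, is_invariant D Y.
Proof.
move=> [Y inv]; set A := dist_coef D; set F := hyp_eq Y; set d := dist_deg D.
have F0 : F != 0 := hyp_neq0 Y; have hF : F \is (hyp_deg Y).-homog := hyp_homog Y.
have mE : hyp_deg Y = (hyp_deg Y).-1.+1 by rewrite prednK // hyp_deg_gt0.
have hA i : A i \is d.+1.-homog by apply: dist_homog.
have hdF i : F^`M(i) \is (hyp_deg Y).-1.-homog.
  by apply: mderiv_homog; rewrite -mE.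
have /fin_all_exists [T0 T0E] (i : 'I_n.+1) :
    exists T0 : 'I_n.+1 -> {mpoly k[n.+1]}, forall j,
      wedge11 A (fun i => F^`M(i)) i j = F * T0 j.
  have /fin_all_exists [T0 E] (j : 'I_n.+1) := invariant_dvd (ltnW hn) i j inv.
  by exists T0.
(* Passing to degree [d] keeps the equation, since [F] and the coefficients of Omega /\ dF are
   homogeneous. *)
pose T i j := pihomog mdeg d (T0 i j).
have TE i j : wedge11 A (fun i => F^`M(i)) i j = F * T i j.
  rewrite /T -(pihomogMl _ _ hF) -T0E pihomog_dE //.
  have -> : (hyp_deg Y + d = d.+1 + (hyp_deg Y).-1)%N by rewrite {1}mE; lia.
  by apply: rpredB; apply: dhomogM.
(* Multiplied by [F], this is Omega /\ Omega /\ dF = 0. *)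
have AT i j l : wedge12 A T i j l = 0.
  apply: (mulfI F0); rewrite mulr0 /wedge12.
  transitivity (A i * (F * T j l) - A j * (F * T i l) + A l * (F * T i j)).
    by ring.
  by rewrite -!TE /wedge11; ring.
(* The n - 2 forms and the codimension 3 add up to n + 1; the subtraction is exact because 2 <=
   n. *)
have gA : cut_empty (n - 2) (adj (fun p => p = 0) A).
  have iZ : ideal (fun p : {mpoly k[n.+1]} => p = 0).
    by split=> [//|p p' -> ->|p p' ->]; rewrite ?addr0 ?mulr0.
  have hZ : hideal (fun p : {mpoly k[n.+1]} => p = 0).
    by split=> // e p ->; rewrite pihomog0.
  apply: (@codim_ge_cut_empty _ _ _ 3 _ (hideal_adj hZ hA)); first by lia.
  move=> W irW WA; apply: hS => // v Wv; split.
    by case: irW => [[C [_ WE]] _ _]; case/WE: Wv.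
  by move=> i; apply: WA Wv _; apply: adj_gen.
have T_eq0 i j : T i j = 0.
  apply: (@wedge12_eq0_of_cut_empty _ _ (n - 2) d _ A) => //; first by lia.
  by move=> i' j'; apply: pihomogP.
have AF i j : wedge11 A (fun i => F^`M(i)) i j = 0 by rewrite TE T_eq0 mulr0.
have [/existsP [j0 g0]|] := boolP [exists j, F^`M(j) != 0].
  by apply: hD; apply: wedge11_deriv_integrable AF _ g0.
rewrite negb_exists => /forallP dF.
rewrite mE in hF; apply: mderiv_eq0_not_square_free F0 hF _ (@hyp_reduced _ _ Y).
by move=> i; apply/eqP/negPn/dF.
Qed.
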